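(* Let $\Gamma>0$ and let $\sigma$ be the semicircle law on $[-2,2]$. Set $$m_c=\sqrt{\tfrac{1+2\Gamma}{1+\Gamma}},\quad m_L=1+\tfrac{\Gamma}{2(1+\Gamma)},\quad \overline m=\sqrt{1+\Gamma},\quad m_U=1+\tfrac{\Gamma(1+2\Gamma)}{2(1+\Gamma)},$$ so that $1<m_c<m_L<\overline m<m_U$, and $$\mathcal I(\alpha,\beta)=J_1\Big(\frac\alpha\beta\Big)-\frac14(\alpha^{-1}-\beta^{-1})^2,\qquad \mathfrak T(\alpha)=\Gamma^{-1}\Big(\alpha+\frac1\alpha-2\Big)\Big[2m-\alpha-\frac1\alpha-\Gamma\Big].$$ (a) The quenched good rate function $I^G_\sigma(\cdot;\pm2,\Gamma)$ is given, for $m\in(1,\infty)$, by $$I^G_\sigma(m;\pm2,\Gamma)=\mathcal I(\alpha_q,\beta_q)+\tfrac12\mathfrak T(\alpha_q)\mathbf 1_{\{m\ge m_U\}},$$ where $\alpha_q\le\beta_q$ if and only if $m\le\overline m$, and $$(\alpha_q,\beta_q)=\begin{cases}\big(1,\frac{\Gamma}{2(m-1)}\big),& m\in(1,m_L],\\[2pt] \big(m_c^{-2}[m+\sqrt{m^2-m_c^2}],\,(1+\Gamma)[m-\sqrt{m^2-m_c^2}]\big),& m\in(m_L,m_U),\\[2pt] \big(\frac12[(m+1)+\sqrt{(m+1)^2-4-2\Gamma}],\,1\big),& m\in[m_U,\infty).\end{cases}$$ (b) The annealed good rate function $I^{G,A}(m;\Gamma)$ is strictly convex; it equals the quenched rate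 function $I^G_\sigma(m;\pm2,\Gamma)$ for $m\in[1,m_U]$, whereas for $m>m_U$, $$I^{G,A}(m;\Gamma)=\mathcal I(\alpha_a,\beta_a^{-1}),\qquad (\alpha_a,\beta_a^{-1})=\big(m_c^{-2}[m+\sqrt{m^2-m_c^2}],\,(1+\Gamma)[m-\sqrt{m^2-m_c^2}]\big).$$
   Context: $\sigma$ has density $(2\pi)^{-1}\sqrt{4-x^2}\,1_{|x|\le2}$. $J_1(y)=\frac12(y-1-\log y)$ for $y>0$; $\mathcal I(\alpha,\beta)$ is defined for $\alpha,\beta>0$. $M_+(J)$ is the set of finite Borel measures on $J\subseteq\mathbb R$. For $\nu\in M_+((-\infty,\xi])$, $F(\xi,\nu;\Gamma)=\frac12\inf_{\theta>\xi}\big[\theta+\Gamma\int\frac{\nu(dx)}{\theta-x}\big]$. For a probability measure $\mu$ and finite measure $\nu$, $H(\mu|\nu)=\int d\mu\log\frac{d\mu}{d\nu}+\nu(\mathbb R)-1$ if $\mu\ll\nu$, and $\infty$ otherwise. For $\psi^*\ge2$, $$I^G_\sigma(m;\pm\psi^*,\Gamma)=\inf\{\tfrac12H(\sigma|\nu):\nu\in M_+([-\psi^*,\psi^*]),\ m=F(\psi^*,\nu;\Gamma)\}$$ (infimum over the empty set equals $+\infty$). The annealed rate function is $$I^{G,A}(m;\Gamma)=\inf_{\psi^*\ge2}\{I^G_\sigma(m;\pm\psi^*,\Gamma)+I_e(\psi^* )\},\qquad I_e(\psi)=\int_2^\psi\sqrt{(u/2)^2-1}\,du\quad(\psi\ge2).$$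 Both rate functions are extended-real valued (equal to $+\infty$ for $m\le1$); strict convexity is understood where the function is finite. *)

(* Defs.v *)
From HB Require Import structures.
From mathcomp Require Import all_boot all_order all_algebra.
From mathcomp Require Import all_classical all_reals all_analysis.
From mathcomp Require Import measurable_realfun lra ring.
Import Order.TTheory GRing.Theory Num.Theory.
Import numFieldNormedType.Exports.

Set Implicit Arguments.
Unset Strict Implicit.
Unset Printing Implicit Defensive.

Local Open Scope classical_set_scope.
Local Open Scope charge_scope.
Local Open Scope ring_scope.

Section semicircle.
Context {R : realType}.
Notation mu := (@lebesgue_measure R).

Definition semicircle_pdf (x : R) : R :=
  (2 * pi)^-1 * Num.sqrt (4 - x ^+ 2) * (`|x| <= 2)%R%:R.

Lemma semicircle_pdf_ge0 x : 0 <= semicircle_pdf x.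
Proof.
rewrite /semicircle_pdf mulr_ge0 ?ler0n// mulr_ge0 ?sqrtr_ge0//.
by rewrite invr_ge0 mulr_ge0 ?pi_ge0.
Qed.

Lemma semicircle_pdfE x :
  semicircle_pdf x = (2 * pi)^-1 * Num.sqrt (4 - x ^+ 2).
Proof.
rewrite /semicircle_pdf; case: leP => /= hx; first by rewrite mulr1.
rewrite mulr0 ler0_sqrtr ?mulr0// subr_le0 -real_normK ?num_real//.
nra.
Qed.

Let continuous_sq : continuous (fun x : R => Num.sqrt (4 - x ^+ 2)).
Proof.
move=> x; apply: continuous_comp; last exact: sqrt_continuous.
by apply: continuousB; [exact: cst_continuous|exact: exprn_continuous].
Qed.

Lemma measurable_semicircle_pdf : measurable_fun setT semicircle_pdf.
Proof.
rewrite (_ : semicircle_pdf =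
  fun x => (2 * pi)^-1 * Num.sqrt (4 - x ^+ 2)); last first.
  by apply/funext => x; exact: semicircle_pdfE.
apply: measurable_funM => //.
by apply: continuous_measurable_fun; exact: continuous_sq.
Qed.

Let is_derive_sin2 (t : R) : is_derive t 1 (fun t => 2 * sin t) (2 * cos t).
Proof.
by apply: is_derive_eq.
Qed.

Let derive1_sin2 : (fun t : R => 2 * sin t)^`()%classic = (fun t => 2 * cos t).
Proof. by apply/funext => t; rewrite derive1E derive_val. Qed.

Let continuous_cos2 : continuous (fun t : R => 2 * cos t).
Proof.
by move=> x; apply: cvgM; [exact: cvg_cst|exact: continuous_cos].
Qed.

Let continuous_sin2 : continuous (fun t : R => 2 * sin t).
Proof.
by move=> x; apply: cvgM; [exact: cvg_cst|exact: continuous_sin].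
Qed.

Let integral_semicircle_sqrt :
  (\int[mu]_(x in `[(-2)%R, 2%R]) (Num.sqrt (4 - x ^+ 2))%:E = (2 * pi)%:E)%E.
Proof.
have pi0 : - (pi / 2) < pi / 2 :> R by have := pi_gt0 R; lra.
have e1 : -2 = 2 * sin (- (pi / 2)) :> R by rewrite sinN sin_pihalf mulrN1.
have e2 : 2 = 2 * sin (pi / 2) :> R by rewrite sin_pihalf mulr1.
rewrite [in X in integral _ X]e1 [X in `[_, X]]e2.
rewrite (@integration_by_substitution_increasing R (fun t => 2 * sin t)
  (fun x => Num.sqrt (4 - x ^+ 2))).
- rewrite derive1_sin2.
  transitivity (\int[mu]_(t in `[(- (pi / 2))%R, (pi / 2)%R])
      (4 * cos t ^+ 2)%:E)%E.
    apply: eq_integral => t /[!inE]/= /[!in_itv]/= ht; congr EFin.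
    change (Num.sqrt (4 - (2 * sin t) ^+ 2) * (2 * cos t) = 4 * cos t ^+ 2).
    rewrite (_ : 4 - (2 * sin t) ^+ 2 = (2 * cos t) ^+ 2); last first.
      by rewrite !exprMn sin2cos2; ring.
    rewrite sqrtr_sqr ger0_norm; last first.
      by rewrite mulr_ge0// cos_ge0_pihalf.
    by ring.
  rewrite (@continuous_FTC2 R _ (fun t => 2 * t + 2 * (sin t * cos t)))//.
  + rewrite cosN cos_pihalf !mulr0 !addr0 -EFinB; congr EFin.
    by field.
  + apply: continuous_subspaceT => x.
    apply: cvgM; first exact: cvg_cst.
    rewrite expr2; under [X in X @ _]eq_fun do rewrite expr2.
    by apply: cvgM; exact: continuous_cos.
  + have cF : continuous (fun t : R => 2 * t + 2 * (sin t * cos t)).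
      move=> x; apply: cvgD; first by apply: cvgM; [exact: cvg_cst|exact: cvg_id].
      apply: cvgM; first exact: cvg_cst.
      by apply: cvgM; [exact: continuous_sin|exact: continuous_cos].
    split.
    * by move=> x _; exact: ex_derive.
    * exact/cvg_at_right_filter/cF.
    * exact/cvg_at_left_filter/cF.
  + move=> x _; rewrite derive1E derive_val.
    by rewrite /GRing.scale/= mulrN -!expr2 cos2sin2; ring.
- exact: ltW.
- move=> x y hx hy xy; rewrite ltr_pM2l//.
  by rewrite ltr_sin.
- by rewrite derive1_sin2 => x _; exact: continuous_cos2.
- rewrite derive1_sin2; apply/cvg_ex; exists (2 * cos (- (pi / 2))).
  exact/cvg_at_right_filter/continuous_cos2.
- rewrite derive1_sin2; apply/cvg_ex; exists (2 * cos (pi / 2)).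
  exact/cvg_at_left_filter/continuous_cos2.
- split.
  + by move=> x _; exact: ex_derive.
  + exact/cvg_at_right_filter/continuous_sin2.
  + exact/cvg_at_left_filter/continuous_sin2.
- by apply: continuous_subspaceT; exact: continuous_sq.
Qed.

Lemma integral_semicircle_pdf : (\int[mu]_x (semicircle_pdf x)%:E = 1)%E.
Proof.
have H : (\int[mu]_x (semicircle_pdf x)%:E =
    \int[mu]_(x in `[(-2)%R, 2%R]) (semicircle_pdf x)%:E)%E.
  rewrite [RHS]integral_mkcond; apply: eq_integral => x _; rewrite patchE.
  case: ifPn => //; rewrite notin_setE/= in_itv/= -ler_norml => /negP/negbTE h.
  by rewrite /semicircle_pdf h mulr0.
rewrite H.
under eq_integral do rewrite semicircle_pdfE EFinM.
have p0 : 0 < 2 * pi :> R by rewrite mulr_gt0// pi_gt0.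
rewrite ge0_integralZl//=.
- by rewrite integral_semicircle_sqrt -EFinM mulVf// gt_eqF.
- apply/measurable_EFinP; apply: measurable_funTS.
  exact: continuous_measurable_fun.
- by rewrite lee_fin invr_ge0 ltW.
Qed.

Definition semicircle_law : set (measurableTypeR R) -> \bar R :=
  fun A => (\int[mu]_(x in A) (semicircle_pdf x)%:E)%E.

Let semicircle0 : semicircle_law set0 = 0%E.
Proof. by rewrite /semicircle_law integral_set0. Qed.

Let semicircle_ge0 A : (0 <= semicircle_law A)%E.
Proof. by apply: integral_ge0 => x _; rewrite lee_fin semicircle_pdf_ge0. Qed.

Let semicircle_sigma_additive : semi_sigma_additive semicircle_law.
Proof.
move=> /= F mF tF mUF; rewrite /semicircle_law; apply: cvg_toP.
  apply: ereal_nondecreasing_is_cvgn => m n mn.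
  apply: lee_sum_nneg_natr => // k _ _.
  by apply: integral_ge0 => /= x Fkx; rewrite lee_fin semicircle_pdf_ge0.
rewrite ge0_integral_bigcup//=.
- apply: measurable_funTS; apply: measurableT_comp => //.
  exact: measurable_semicircle_pdf.
- by move=> x _; rewrite lee_fin semicircle_pdf_ge0.
Qed.

HB.instance Definition _ := isMeasure.Build _ _ _ semicircle_law
  semicircle0 semicircle_ge0 semicircle_sigma_additive.

Let semicircle_setT : semicircle_law [set: _] = 1%:E.
Proof. exact: integral_semicircle_pdf. Qed.

HB.instance Definition _ := @Measure_isProbability.Build _ _ R
  semicircle_law semicircle_setT.

End semicircle.
Arguments semicircle_law R : clear implicits.

Section rate_functions.
Context {R : realType}.
Local Notation borel := (measurableTypeR R).
Implicit Types (m psi xi Gamma alpha beta : R).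

(* Elements of M_+(J) are represented as finite Borel measures on R that give
   no mass to the complement of J. *)
Definition M_plus (J : set R) : set {finite_measure set borel -> \bar R} :=
  [set nu | nu (~` J) = 0%E].

Definition F xi (nu : {finite_measure set borel -> \bar R}) Gamma : \bar R :=
  (2^-1%:E * ereal_inf [set theta%:E +
     Gamma%:E * \int[nu]_(x in `]-oo, xi]) (theta - x)^-1%:E
     | theta in [set theta : R | (xi < theta)%R]])%E.

(* On the mu-negligible set where d mu / d nu vanishes, ln takes the dummy
   value 0; this does not affect the integral. *)
Definition H (mu : probability borel R)
    (nu : {finite_measure set borel -> \bar R}) : \bar R :=
  if `[< mu `<< nu >] then
    (\int[mu]_x (ln (fine (('d (charge_of_finite_measure mu) '/d nu) x)))%:E
     + nu setT - 1)%E
  else +oo%E.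

Definition I_G (mu : probability borel R) m psi Gamma : \bar R :=
  ereal_inf [set (2^-1%:E * H mu nu)%E | nu in
    [set nu | M_plus `[- psi, psi] nu /\ m%:E = F psi nu Gamma]].

Definition I_e psi : \bar R :=
  (\int[lebesgue_measure]_(u in `[2%R, psi]) (Num.sqrt ((u / 2) ^+ 2 - 1))%:E)%E.

Definition I_GA m Gamma : \bar R :=
  ereal_inf [set (I_G (semicircle_law R) m psi Gamma + I_e psi)%E
    | psi in [set psi | 2 <= psi]].

Definition good_rate_function (f : R -> \bar R) :=
  (forall m, (0 <= f m)%E) /\
  (forall c : R, compact [set m | (f m <= c%:E)%E]).

Definition strictly_convex (f : R -> \bar R) :=
  forall x y t : R, f x \is a fin_num -> f y \is a fin_num -> x != y ->
    0 < t < 1 -> (f (t * x + (1 - t) * y)%R < t%:E * f x + (1 - t)%:E * f y)%E.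

Definition m_c Gamma : R := Num.sqrt ((1 + 2 * Gamma) / (1 + Gamma)).
Definition m_L Gamma : R := 1 + Gamma / (2 * (1 + Gamma)).
Definition m_bar Gamma : R := Num.sqrt (1 + Gamma).
Definition m_U Gamma : R :=
  1 + Gamma * (1 + 2 * Gamma) / (2 * (1 + Gamma)).

Definition J_1 (y : R) : R := 2^-1 * (y - 1 - ln y).

Definition calI alpha beta : R :=
  J_1 (alpha / beta) - 4^-1 * (alpha^-1 - beta^-1) ^+ 2.

Definition frakT Gamma m alpha : R :=
  Gamma^-1 * (alpha + alpha^-1 - 2) * (2 * m - alpha - alpha^-1 - Gamma).

Definition alpha_a Gamma m : R :=
  m_c Gamma ^- 2 * (m + Num.sqrt (m ^+ 2 - m_c Gamma ^+ 2)).
(* This is beta_a^{-1}. *)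
Definition beta_aV Gamma m : R :=
  (1 + Gamma) * (m - Num.sqrt (m ^+ 2 - m_c Gamma ^+ 2)).

Definition alpha_q Gamma m : R :=
  if m <= m_L Gamma then 1
  else if m < m_U Gamma then
    m_c Gamma ^- 2 * (m + Num.sqrt (m ^+ 2 - m_c Gamma ^+ 2))
  else 2^-1 * ((m + 1) + Num.sqrt ((m + 1) ^+ 2 - 4 - 2 * Gamma)).

Definition beta_q Gamma m : R :=
  if m <= m_L Gamma then Gamma / (2 * (m - 1))
  else if m < m_U Gamma then
    (1 + Gamma) * (m - Num.sqrt (m ^+ 2 - m_c Gamma ^+ 2))
  else 1.

End rate_functions.

(* Main.v *)
(** For [a >= 1] write [J a = a + 1 / a]. The Stieltjes transform of the semicircle
    law at [J a] is [1 / a], and integrating it shows that its logarithmic potential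
    at [J a] is, up to a constant, [ln a + 1 / (2 a^2)].

    Lower bounds: by Gibbs' inequality [H sigma nu >= int ln w dsigma + nu(R) - int w dnu]
    for every test function [w >= 0]. With [w x = (J t - x) / (J a - x)] the right-hand
    side only depends on [int nu(dx) / (J a - x)], which the constraint [m = F psi nu Gamma]
    controls. When the optimal [w] has [t > a], an upper bound on that integral is needed;
    it is available only at near-minimizers [theta] of [F], and convexity of
    [theta |-> ln ((theta + k - x) / (theta - x))] reduces to [theta = J a].

    Upper bounds: [nu = (J a - x) / (J b - x) sigma + c delta_psi] attains these bounds
    when [J a] is the minimizer in [F]. Without atom this forces [a b = 1 + Gamma], unless
    [a = 1]; as [m] grows the constraint [b >= 1] becomes active, at [m = m_U]. Then an
    atom appears at [2] in the quenched case, whereas in the annealed case it is better to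
    pay [I_e] and move it to [J v] with [v = a / (1 + Gamma)].

    Parametrizing by [a], the annealed rate has the strictly increasing derivative
    [a / (1 + Gamma) - 1 / a] in [m], whence strict convexity. Sublevel sets
    are closed because the annealed rate, and the quenched one beyond [m_U], are suprema
    of affine functions. *)

Require Import Defs.
From HB Require Import structures.
From mathcomp Require Import all_boot all_order all_algebra.
From mathcomp Require Import all_classical all_reals all_analysis.
From mathcomp Require Import measurable_realfun lra ring.
Import Order.TTheory GRing.Theory Num.Theory.
Import numFieldNormedType.Exports.

Set Implicit Arguments.
Unset Strict Implicit.
Unset Printing Implicit Defensive.

Local Open Scope classical_set_scope.
Local Open Scope ring_scope.

(** * Integrals with a finite real value *)

Section has_integral.
Context d (T : measurableType d) (R : realType) (mu : {measure set T -> \bar R}).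
Implicit Types (D : set T) (f g : T -> R).

(** Joining integrability to a real value lets linear combinations be computed in [R], away from the
    side conditions of extended-real arithmetic. *)
Definition has_integral D f (v : R) :=
  mu.-integrable D (EFin \o f) /\ (\int[mu]_(x in D) (f x)%:E = v%:E)%E.

Lemma has_integral_eq D f g v w : measurable D -> {in D, f =1 g} -> v = w ->
  has_integral D f v -> has_integral D g w.
Proof.
move=> mD fg <- [fi fv]; split.
  by apply: eq_integrable fi => // x xD /=; rewrite fg.
by rewrite -fv; apply: eq_integral => x xD; rewrite fg.
Qed.

Lemma has_integralD D f g v w : measurable D ->
  has_integral D f v -> has_integral D g w ->
  has_integral D (fun x => f x + g x) (v + w).
Proof.
move=> mD [fi fv] [gi gw]; split.
  by apply: eq_integrable (integrableD mD fi gi).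
by rewrite EFinD -fv -gw -integralD_EFin.
Qed.

Lemma has_integralZ D k f v : measurable D -> has_integral D f v ->
  has_integral D (fun x => k * f x) (k * v).
Proof.
move=> mD [fi fv]; split.
  by apply: eq_integrable (integrableZl mD k fi).
by rewrite EFinM -fv -integralZl.
Qed.

Lemma has_integralB D f g v w : measurable D ->
  has_integral D f v -> has_integral D g w ->
  has_integral D (fun x => f x - g x) (v - w).
Proof.
move=> mD If /(has_integralZ (-1) mD) Ig.
by have := has_integralD mD If Ig; apply: has_integral_eq => //= [x _|]; rewrite mulN1r.
Qed.

Lemma has_integral_le D f g v w : measurable D -> (forall x, D x -> f x <= g x) ->
  has_integral D f v -> has_integral D g w -> v <= w.
Proof.
move=> mD fg [fi fv] [gi gw]; rewrite -lee_fin -fv -gw.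
by apply: le_integral => // x /set_mem Dx; rewrite lee_fin fg.
Qed.

Lemma integrable_has_integral D f : measurable D -> mu.-integrable D (EFin \o f) ->
  has_integral D f (fine (\int[mu]_(x in D) (f x)%:E)%E).
Proof. by move=> mD fi; split => //; rewrite fineK// integrable_fin_num. Qed.

Lemma ge0_has_integral D f v : measurable D -> measurable_fun D f ->
  (forall x, D x -> 0 <= f x) -> (\int[mu]_(x in D) (f x)%:E = v%:E)%E ->
  has_integral D f v.
Proof.
move=> mD mf f0 fv; split => //; apply/integrableP; split.
  exact/measurable_EFinP.
under eq_integral => x /set_mem Dx do rewrite /= ger0_norm ?f0//.
by rewrite fv ltry.
Qed.

Lemma bounded_integrable D f M : measurable D -> (mu D < +oo)%E ->
  measurable_fun D f -> (forall x, D x -> `|f x| <= M) ->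
  mu.-integrable D (EFin \o f).
Proof.
move=> mD Dfin mf fM; apply: measurable_bounded_integrable => //.
by exists M; split; rewrite ?num_real// => N MN x /= Dx; rewrite (le_trans (fM _ Dx))// ltW.
Qed.

(** Measurability is the only regularity at hand for the logarithm of a density, to which this is
    applied; positive and negative parts are therefore compared separately. *)
Lemma le_integral_measurable D (f g : T -> \bar R) : measurable D ->
  measurable_fun D f -> measurable_fun D g -> (forall x, D x -> (f x <= g x)%E) ->
  (\int[mu]_(x in D) f x <= \int[mu]_(x in D) g x)%E.
Proof.
move=> mD mf mg fg; rewrite integralE [leRHS]integralE leeB//.
- apply: ge0_le_integral => //; [exact: measurable_funepos|exact: measurable_funepos|].
  by move=> x /mem_set; apply: funepos_le => y /set_mem; exact: fg.
- apply: ge0_le_integral => //; [exact: measurable_funeneg|exact: measurable_funeneg|].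
  by move=> x /mem_set; apply: funeneg_le => y /set_mem; exact: fg.
Qed.

Lemma integral_setDnull D N (f : T -> \bar R) : measurable D -> measurable N ->
  measurable_fun D f -> mu N = 0%E ->
  (\int[mu]_(x in D) f x = \int[mu]_(x in D `\` N) f x)%E.
Proof.
move=> mD mN mf N0; rewrite integralE [RHS]integralE; congr (_ - _)%E;
  apply: ge0_negligible_integral => //.
  exact: measurable_funepos.
exact: measurable_funeneg.
Qed.

End has_integral.

(** * Measures given by a density *)

Section density.
Local Open Scope ereal_scope.
Context d (T : measurableType d) (R : realType).
Variables (m : {sigma_finite_measure set T -> \bar R})
          (nu : {finite_measure set T -> \bar R}) (g : T -> R).
Hypotheses (mg : measurable_fun setT g) (g0 : forall x, (0 <= g x)%R).
Hypothesis nuE : forall A, measurable A -> nu A = \int[m]_(x in A) (g x)%:E.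

(** The change of variables holds for the Radon-Nikodym derivative of [nu], which agrees with [g]
    almost everywhere because both have the same integral over every measurable set. *)
Lemma ge0_integral_density E (f : T -> \bar R) : measurable E ->
  measurable_fun E f -> (forall x, E x -> 0 <= f x) ->
  \int[nu]_(x in E) f x = \int[m]_(x in E) (f x * (g x)%:E).
Proof.
move=> mE mf f0.
have num : nu `<< m.
  apply/null_content_dominatesP => A mA A0; rewrite nuE//.
  by apply: null_set_integral => //; exact/measurable_EFinP/measurable_funTS.
have mh : measurable_fun E (f \_ E) by apply/measurable_restrict => //; rewrite setIid.
transitivity (\int[nu]_(x in E) (f \_ E) x).
  by apply: eq_integral => x xE; rewrite patchE xE.
rewrite -(Radon_Nikodym_SigmaFinite.change_of_variables num)//; last first.
  by move=> x; rewrite erestrict_ge0.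
set h := Radon_Nikodym_SigmaFinite.f nu m.
have mh1 : measurable_fun setT h.
  exact: measurable_int (Radon_Nikodym_SigmaFinite.f_integrable num).
have mge : measurable_fun setT (fun x => (g x)%:E) by exact/measurable_EFinP.
apply: ge0_ae_eq_integral => //.
- by apply: emeasurable_funM => //; exact: measurable_funTS.
- by apply: emeasurable_funM => //; exact: measurable_funTS.
- by move=> x Ex; apply: mule_ge0; rewrite ?erestrict_ge0//; exact: Radon_Nikodym_SigmaFinite.f_ge0.
- by move=> x Ex; rewrite mule_ge0 ?f0// lee_fin.
have : ae_eq m E h (fun x => (g x)%:E).
  apply: integral_ae_eq => //.
  - by apply: integrableS (Radon_Nikodym_SigmaFinite.f_integrable num).
  - exact: measurable_funTS.
  - by move=> A AE mA; rewrite -nuE// -Radon_Nikodym_SigmaFinite.f_integral.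
apply: filterS => x hx Ex; rewrite patchE mem_set//.
by rewrite hx.
Qed.

End density.

Lemma measurable_funV_gt0 d (T : measurableType d) (R : realType) (D : set T)
    (f : T -> R) : measurable D -> measurable_fun D f ->
  (forall x, D x -> 0 < f x) -> measurable_fun D (fun x => (f x)^-1).
Proof.
move=> mD mf f0; apply: (eq_measurable_fun (fun x => expR (- ln (f x)))).
  by move=> x /set_mem Dx; rewrite expRN lnK// posrE f0.
apply: (measurableT_comp (@measurable_expR R)); apply: measurable_funN.
exact: (measurableT_comp (@measurable_ln R)).
Qed.

(** * Calculus on segments and integrals against the semicircle law *)

Section segment_calculus.
Context {R : realType}.
Notation mu := (@lebesgue_measure R).
Implicit Types (f F G : R -> R) (a b : R).

Lemma is_derive_cvg F (x l : R) : is_derive x 1 F l -> {for x, continuous F}.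
Proof. by move=> [Fx _]; exact/differentiable_continuous/derivable1_diffP. Qed.

Lemma is_derive_ln_comp F (x l : R) : 0 < F x -> is_derive x 1 F l ->
  is_derive x 1 (fun y => ln (F y)) ((F x)^-1 * l).
Proof. by move=> Fx0 dF; have := is_derive1_comp (is_derive1_ln Fx0) dF. Qed.

Lemma is_derive_inv F (x l : R) : F x != 0 -> is_derive x 1 F l ->
  is_derive x 1 (fun y => (F y)^-1) (- (F x) ^- 2 * l).
Proof.
move=> Fx0 [Fx <-]; apply: DeriveDef; first exact: derivableV.
by rewrite deriveV.
Qed.

Lemma continuous_at_within f a b :
  (forall x, a <= x <= b -> {for x, continuous f}) -> {within `[a, b], continuous f}.
Proof.
move=> cf; apply: continuous_in_subspaceT => x /set_mem /=; rewrite in_itv/=.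
exact: cf.
Qed.

Lemma has_integral_FTC a b f F : a < b ->
  (forall x, a <= x <= b -> {for x, continuous f}) ->
  (forall x, a <= x <= b -> is_derive x 1 F (f x)) ->
  has_integral mu `[a, b] f (F b - F a).
Proof.
move=> ab cf dF; have cw := continuous_at_within cf; split.
  by apply: continuous_compact_integrable => //; exact: segment_compact.
rewrite (continuous_FTC2 ab cw (F := F))//.
- split.
  + by move=> x /[!in_itv]/= /andP[ax xb]; have [] := dF x; rewrite ?ltW.
  + apply: cvg_at_right_filter; apply: (@is_derive_cvg F a (f a)).
    by apply: dF; rewrite lexx ltW.
  + apply: cvg_at_left_filter; apply: (@is_derive_cvg F b (f b)).
    by apply: dF; rewrite lexx ltW.
- move=> x /[!in_itv]/= /andP[ax xb]; rewrite derive1E.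
  by have [_ <-] : is_derive x 1 F (f x) by apply: dF; rewrite !ltW.
Qed.

Lemma substitution_segment a b F f G : a < b ->
  {in `[a, b] &, {homo F : x y / x < y}} ->
  (forall x, a <= x <= b -> is_derive x 1 F (f x)) ->
  (forall x, a <= x <= b -> {for x, continuous f}) ->
  {within `[F a, F b], continuous G} ->
  (\int[mu]_(x in `[F a, F b]) (G x)%:E =
   \int[mu]_(t in `[a, b]) (G (F t) * f t)%:E)%E.
Proof.
move=> ab Fincr dF cf cG.
have F'E x : a <= x <= b -> F^`()%classic x = f x.
  by move=> /dF[_ <-]; rewrite derive1E.
rewrite (@integration_by_substitution_increasing R F G a b) ?ltW//.
- apply: eq_integral => t /set_mem/= /[!in_itv]/= abt.
  by rewrite fctE/= F'E.
- move=> x /[!in_itv]/= /andP[ax xb].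
  have abx : a <= x <= b by rewrite !ltW.
  (* Near an interior point the derivative of [F] coincides with [f], whose continuity it
     inherits. *)
  have E : \forall y \near x, f y = F^`()%classic y.
    near=> y; rewrite F'E//.
    have : y \in `]a, b[ by near: y; apply: near_in_itvoo; rewrite in_itv/= ax.
    by rewrite in_itv/= => /andP[? ?]; rewrite !ltW.
  rewrite /prop_for /continuous_at F'E//.
  by apply: cvg_trans (cf x abx); apply: near_eq_cvg.
- apply/cvg_ex; exists (f a).
  have cfa : f x @[x --> a^'+] --> f a.
    by apply: cvg_at_right_filter; apply: cf; rewrite lexx ltW.
  apply: cvg_trans cfa; apply: near_eq_cvg; near=> x; rewrite F'E//.
  by apply/andP; split; apply: ltW; near: x; [exact: nbhs_right_gt|exact: nbhs_right_lt].
- apply/cvg_ex; exists (f b).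
  have cfb : f x @[x --> b^'-] --> f b.
    by apply: cvg_at_left_filter; apply: cf; rewrite lexx ltW.
  apply: cvg_trans cfb; apply: near_eq_cvg; near=> x; rewrite F'E//.
  by apply/andP; split; apply: ltW; near: x; [exact: nbhs_left_gt|exact: nbhs_left_lt].
- split.
  + by move=> x /[!in_itv]/= /andP[ax xb]; have [] := dF x; rewrite ?ltW.
  + apply: cvg_at_right_filter; apply: (@is_derive_cvg F a (f a)).
    by apply: dF; rewrite lexx ltW.
  + apply: cvg_at_left_filter; apply: (@is_derive_cvg F b (f b)).
    by apply: dF; rewrite lexx ltW.
Unshelve. all: by end_near. Qed.

Lemma is_derive_mono_le a b F f : a <= b ->
  (forall x, a <= x <= b -> is_derive x 1 F (f x)) ->
  (forall x, a < x < b -> 0 <= f x) -> F a <= F b.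
Proof.
move=> ab dF f0.
have cF : {within `[a, b], continuous F}.
  by apply: continuous_at_within => x abx; exact: is_derive_cvg (dF x abx).
have [c /[!in_itv]/= abc E] : exists2 c, c \in `[a, b]%R & F b - F a = f c * (b - a).
  by apply: (@MVT_segment R F f a b) => // x /[!in_itv]/= /andP[ax xb]; apply: dF; rewrite !ltW.
rewrite -subr_ge0.
move: ab; rewrite le_eqVlt => /predU1P[->|ab]; first by rewrite subrr.
have [c' /[!in_itv]/= abc' ->] : exists2 c, c \in `]a, b[%R & F b - F a = f c * (b - a).
  by apply: (@MVT R F f a b) => // x /[!in_itv]/= /andP[ax xb]; apply: dF; rewrite !ltW.
by rewrite mulr_ge0 ?f0// subr_ge0 ltW.
Qed.

Lemma is_derive_mono_lt a b F f : a < b ->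
  (forall x, a <= x <= b -> is_derive x 1 F (f x)) ->
  (forall x, a < x < b -> 0 < f x) -> F a < F b.
Proof.
move=> ab dF f0.
have [c /[!in_itv]/= abc E] : exists2 c, c \in `]a, b[%R & F b - F a = f c * (b - a).
  apply: (@MVT R F f a b) => //.
    by move=> x /[!in_itv]/= /andP[ax xb]; apply: dF; rewrite !ltW.
  by apply: continuous_at_within => x abx; exact: is_derive_cvg (dF x abx).
by rewrite -subr_gt0 E mulr_gt0 ?f0// subr_gt0.
Qed.

End segment_calculus.

Section semicircle_integrals.
Context {R : realType}.
Notation mu := (@lebesgue_measure R).
Notation sigma := (semicircle_law R).
Notation D := (`](-2), 2[%classic : set (measurableTypeR R)).

Lemma semicircle_measureE (A : set (measurableTypeR R)) :
  sigma A = (\int[mu]_(x in A) (semicircle_pdf x)%:E)%E.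
Proof. by []. Qed.

(** The density vanishes at the endpoints too. Working on the open interval keeps [J a - x] positive
    even for [a = 1]. *)
Lemma semicircle_setC : sigma (~` D) = 0%E.
Proof.
have -> : sigma (~` D) = (\int[mu]_(x in ~` D) (cst 0%E x))%E.
  rewrite semicircle_measureE; apply: eq_integral => x /set_mem /=.
  rewrite in_itv/= => /negP; rewrite -ltr_norml -leNgt => x2.
  rewrite semicircle_pdfE; congr EFin.
  rewrite ler0_sqrtr ?mulr0// subr_le0 -real_normK ?num_real//.
  by have := normr_ge0 x; nra.
exact: integral0.
Qed.

Lemma semicircle_D : sigma D = 1%E.
Proof.
have <- : sigma setT = 1%E by exact: probability_setT.
rewrite -(setUv D) measureU//; [|exact: measurableC|exact: setICr].
by rewrite [X in (_ + X)%E](_ : _ = 0%E) ?adde0//; exact: semicircle_setC.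
Qed.

Lemma has_integral_cst c : has_integral sigma D (cst c) c.
Proof.
split; first by apply: finite_measure_integrable_cst.
transitivity (\int[sigma]_(x in D) (cst c%:E x))%E => //.
by rewrite integral_cst// [X in (_ * X)%E](_ : _ = 1%E) ?mule1//; exact: semicircle_D.
Qed.

(* The substitution [x = 2 sin t]. *)
Lemma semicircle_has_integral (f Phi : R -> R) :
  (forall x : R, -2 <= x <= 2 -> {for x, continuous f}) ->
  (forall x : R, -2 <= x <= 2 -> 0 <= f x) ->
  (forall t : R, is_derive t 1 Phi (f (2 * sin t) * (4 * cos t ^+ 2))) ->
  has_integral sigma D f ((2 * pi)^-1 * (Phi (pi / 2) - Phi (- (pi / 2)))).
Proof.
move=> cf f0 dPhi.
have pi0 : - (pi / 2) < pi / 2 :> R by have := pi_gt0 R; lra.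
have p0 : 0 < 2 * pi :> R by rewrite mulr_gt0// pi_gt0.
have mf : measurable_fun D f.
  apply: open_continuous_measurable_fun => // x.
  by rewrite inE/= in_itv/= => /andP[? ?]; apply: cf; rewrite !ltW.
have f0D x : D x -> 0 <= f x.
  by rewrite /= in_itv/= => /andP[? ?]; apply: f0; rewrite !ltW.
apply: ge0_has_integral => //.
rewrite (@ge0_integral_density _ _ _ mu (semicircle_law R) (@semicircle_pdf R))//.
(* Closing the interval does not change the Lebesgue integral, and its endpoints become the images
   of [- (pi / 2)] and [pi / 2]. *)
- rewrite -(@integral_itv_bndoo _ _ _ _ true false); last first.
    apply: emeasurable_funM; first exact/measurable_EFinP.
    apply/measurable_EFinP; apply: measurable_funTS.
    exact: measurable_semicircle_pdf.
  transitivity (\int[mu]_(x in `[(-2)%R, 2%R])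
     ((2 * pi)^-1%:E * (f x * Num.sqrt (4 - x ^+ 2))%:E))%E.
    by apply: eq_integral => x _; rewrite -!EFinM semicircle_pdfE; congr EFin; ring.
  have sq : continuous (fun x : R => Num.sqrt (4 - x ^+ 2)).
    move=> x; apply: continuous_comp; last exact: sqrt_continuous.
    by apply: continuousB; [exact: cst_continuous|exact: exprn_continuous].
  have cw : {within `[-2, 2], continuous (fun x => f x * Num.sqrt (4 - x ^+ 2))}.
    apply: continuous_at_within => x x2.
    by apply: continuousM; [exact: cf|exact: sq].
  rewrite integralZl//; last first.
    apply: (continuous_compact_integrable (f := fun x => f x * Num.sqrt (4 - x ^+ 2))) => //.
    exact: segment_compact.
  rewrite EFinM; congr (_ * _)%E.
  have e1 : -2 = 2 * sin (- (pi / 2)) :> R by rewrite sinN sin_pihalf mulrN1.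
  have e2 : 2 = 2 * sin (pi / 2) :> R by rewrite sin_pihalf mulr1.
  have sin2 (t : R) : -2 <= 2 * sin t <= 2.
    by have := sin_geN1 t; have := sin_le1 t; lra.
  rewrite [in X in integral _ X]e1 [X in `[_, X]]e2.
  rewrite (@substitution_segment R (- (pi / 2)) (pi / 2) (fun t => 2 * sin t)
    (fun t => 2 * cos t))//; last 3 first.
  + by move=> x y hx hy xy; rewrite ltr_pM2l// ltr_sin.
  + move=> x _; apply: continuousM; [exact: cst_continuous|exact: continuous_cos].
  + by rewrite -e1 -e2.
  have [//|_ <-] := @has_integral_FTC R (- (pi / 2)) (pi / 2)
    (fun t => f (2 * sin t) * (4 * cos t ^+ 2)) Phi pi0.
    move=> t _; apply: continuousM.
      apply: (@continuous_comp _ _ _ (fun t => 2 * sin t) f); last exact: cf.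
      by apply: continuousM; [exact: cst_continuous|exact: continuous_sin].
    apply: continuousM; first exact: cst_continuous.
    apply: (@continuous_comp _ _ _ (@cos R) (fun x => x ^+ 2)); first exact: continuous_cos.
    exact: exprn_continuous.
  apply: eq_integral => t /set_mem/= /[!in_itv]/= ht; congr EFin.
  rewrite (_ : 4 - (2 * sin t) ^+ 2 = (2 * cos t) ^+ 2); last first.
    by rewrite !exprMn sin2cos2; ring.
  rewrite sqrtr_sqr ger0_norm; last by rewrite mulr_ge0// cos_ge0_pihalf.
  by ring.
- exact: measurable_semicircle_pdf.
- exact: semicircle_pdf_ge0.
- exact/measurable_EFinP.
Qed.

End semicircle_integrals.

(** * The Joukowski parametrization *)

Definition joukowski {R : realType} (a : R) : R := a + a^-1.

Section joukowski.
Context {R : realType}.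
Implicit Types a b t : R.
Notation J := (@joukowski R).

Lemma joukowski1 : J 1 = 2.
Proof. by rewrite /joukowski invr1. Qed.

Lemma joukowskiB a b : 0 < a -> 0 < b ->
  J b - J a = (b - a) * (1 - (a * b)^-1).
Proof. by move=> a0 b0; rewrite /joukowski; field; rewrite !gt_eqF. Qed.

Lemma joukowski_le a b : 1 <= a -> a <= b -> J a <= J b.
Proof.
move=> a1 ab; rewrite -subr_ge0 joukowskiB//; [|lra|lra].
rewrite mulr_ge0 ?subr_ge0// invf_le1; nra.
Qed.

Lemma joukowski_lt a b : 1 <= a -> a < b -> J a < J b.
Proof.
move=> a1 ab; rewrite -subr_gt0 joukowskiB//; [|lra|lra].
by rewrite mulr_gt0 ?subr_gt0// invf_lt1; nra.
Qed.

Lemma joukowski_inj a b : 1 <= a -> 1 <= b -> J a = J b -> a = b.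
Proof.
move=> a1 b1 E; have [ab|ba|//] := ltgtP a b.
  by have := joukowski_lt a1 ab; rewrite E ltxx.
by have := joukowski_lt b1 ba; rewrite E ltxx.
Qed.

Lemma joukowski_ge2 a : 1 <= a -> 2 <= J a.
Proof. by move=> a1; rewrite -joukowski1 joukowski_le. Qed.

Lemma joukowski_gt2 a : 1 < a -> 2 < J a.
Proof. by move=> a1; rewrite -joukowski1 joukowski_lt. Qed.

(** Every point at or beyond the edge [2] can thus be written [J a], which turns the square roots
    attached to the semicircle law into rational functions of [a]. *)
Lemma joukowski_surj t : 2 <= t -> exists2 a, 1 <= a & J a = t.
Proof.
move=> t2; pose s := Num.sqrt (t ^+ 2 - 4).
have ss : s ^+ 2 = t ^+ 2 - 4 by rewrite sqr_sqrtr//; nra.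
have s0 : 0 <= s by exact: sqrtr_ge0.
(* The larger root of [a ^+ 2 - t * a + 1]; the other root [(t - s) / 2] is its inverse. *)
exists ((t + s) / 2); first by lra.
have n0 : (t + s) / 2 != 0 by rewrite gt_eqF//; lra.
have -> : J ((t + s) / 2) = (t + s) / 2 + (t - s) / 2; last by field.
congr (_ + _); apply: (mulfI n0); rewrite mulfV//.
have -> : (t + s) / 2 * ((t - s) / 2) = (t ^+ 2 - s ^+ 2) / 4 by field.
by rewrite ss; field.
Qed.

Lemma is_derive_joukowski a : 0 < a -> is_derive a 1 J (1 - a ^- 2).
Proof.
move=> a0; have a0' : a != 0 by rewrite gt_eqF.
have d : is_derive a 1 (fun y : R => y^-1) (- a ^- 2 * 1).
  by apply: (@is_derive_inv R id).
have := is_deriveD (is_derive_id a 1) d.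
by rewrite mulr1.
Qed.

End joukowski.

(** * The Stieltjes transform of the semicircle law *)

Section stieltjes.
Context {R : realType}.
Notation sigma := (semicircle_law R).
Notation D := (`](-2), 2[%classic : set (measurableTypeR R)).
Notation J := (@joukowski R).
Implicit Types a b x t : R.

Section angle.
Variable a : R.
Hypothesis a1 : 1 < a.

(* An antiderivative of [(a - a^-1) / (J a - 2 sin t)] that is smooth on the
   whole line, unlike the one given by [tan (t / 2)]. *)
Let A t := t - 2 * atan (cos t / (a - sin t)).

Let asin_gt0 t : 0 < a - sin t.
Proof. by rewrite subr_gt0 (le_lt_trans (sin_le1 t)). Qed.

Let Jsin_gt0 t : 0 < J a - 2 * sin t.
Proof. by have := joukowski_gt2 a1; have := sin_le1 t; move: a1; lra. Qed.

Let is_derive_A t : is_derive t 1 A ((a - a^-1) / (J a - 2 * sin t)).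
Proof.
have a1' := a1.
have h := asin_gt0 t; have hJ := Jsin_gt0 t.
have dI : is_derive t 1 (fun y => (a - sin y)^-1) (- (a - sin t) ^- 2 * (- cos t)).
  apply: is_derive_inv; first by rewrite gt_eqF.
  by apply: is_derive_eq (is_deriveB (is_derive_cst a t 1) (is_derive_sin t)) _; rewrite sub0r.
have dG := is_deriveM (is_derive_cos t) dI.
have dT := is_derive1_comp (is_derive1_atan _) dG.
have dA := is_deriveB (is_derive_id t 1) (is_deriveZ 2 dT).
apply: is_derive_eq dA _.
rewrite /GRing.scale/= fctE.
have s2 : cos t ^+ 2 = 1 - sin t ^+ 2 by exact: cos2sin2.
(* All terms are brought to this denominator, which is [a * (J a - 2 * sin t)]. *)
have n1 : a ^+ 2 - 2 * a * sin t + 1 != 0.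
  by rewrite gt_eqF//; have := sin_le1 t; nra.
have E1 : 1 + (cos t / (a - sin t)) ^+ 2 =
    (a ^+ 2 - 2 * a * sin t + 1) / (a - sin t) ^+ 2.
  rewrite exprMn s2 exprVn; field.
  by rewrite gt_eqF.
rewrite E1.
have -> : cos t * (- (a - sin t) ^- 2 * - cos t) + (a - sin t)^-1 * - sin t =
    (1 - a * sin t) / (a - sin t) ^+ 2.
  have -> : cos t * (- (a - sin t) ^- 2 * - cos t) = cos t ^+ 2 / (a - sin t) ^+ 2 by ring.
  by rewrite s2; field; rewrite gt_eqF.
have -> : J a - 2 * sin t = (a ^+ 2 - 2 * a * sin t + 1) / a.
  by rewrite /joukowski; field; rewrite gt_eqF//; lra.
by field; rewrite n1 !gt_eqF//; lra.
Qed.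

Let A_pihalf : A (pi / 2) = pi / 2.
Proof. by rewrite /A cos_pihalf mul0r atan0 mulr0 subr0. Qed.

Let A_Npihalf : A (- (pi / 2)) = - (pi / 2).
Proof. by rewrite /A cosN cos_pihalf mul0r atan0 mulr0 subr0. Qed.

Let a_subV : 0 < a - a^-1.
Proof. by rewrite subr_gt0 (lt_trans _ a1)// invf_lt1//; move: a1; lra. Qed.

Lemma has_integral_stieltjes_gt1 :
  has_integral sigma D (fun x => (J a - x)^-1) a^-1.
Proof.
have a1' := a1.
have J2 := joukowski_gt2 a1.
have c0 x : -2 <= x <= 2 -> 0 < J a - x by move=> /andP[? ?]; lra.
(* Dividing [4 * cos t ^+ 2] by [J a - 2 * sin t] gives the quotient [J a + 2 * sin t] and the
   remainder [4 - J a ^+ 2 = - (a - a^-1) ^+ 2], whose contribution is integrated by [A]. *)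
pose Phi t := J a * t - 2 * cos t - (a - a^-1) * A t.
have [hi hv] : has_integral sigma D (fun x => (J a - x)^-1)
    ((2 * pi)^-1 * (Phi (pi / 2) - Phi (- (pi / 2)))).
  apply: semicircle_has_integral.
  - move=> x /c0 h; apply: continuousV; first by rewrite gt_eqF.
    by apply: continuousB; [exact: cst_continuous|exact: cvg_id].
  - by move=> x /c0 /ltW; rewrite invr_ge0.
  - move=> t; have hJ := Jsin_gt0 t.
    have d := is_deriveB (is_deriveB (is_deriveZ (J a) (is_derive_id t 1))
      (is_deriveZ 2 (is_derive_cos t))) (is_deriveZ (a - a^-1) (is_derive_A t)).
    apply: is_derive_eq d _; rewrite /GRing.scale/= cos2sin2.
    have -> : (a - a^-1) * ((a - a^-1) / (J a - 2 * sin t)) =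
      (J a ^+ 2 - 4) / (J a - 2 * sin t).
      rewrite mulrA; congr (_ / _); rewrite /joukowski; field.
      by rewrite gt_eqF//; lra.
    by field; rewrite gt_eqF.
split=> //; rewrite hv; congr EFin; rewrite /Phi A_pihalf A_Npihalf cosN cos_pihalf.
have p0 : pi != 0 :> R by rewrite gt_eqF// pi_gt0.
have a0 : a != 0 by rewrite gt_eqF//; lra.
by rewrite /joukowski; move: (pi) p0 => p p0; field; rewrite ?p0 ?a0.
Qed.

Lemma has_integral_stieltjes_sqr :
  has_integral sigma D (fun x => (J a - x) ^- 2) (a ^+ 2 - 1)^-1.
Proof.
have a1' := a1.
have J2 := joukowski_gt2 a1.
have c0 x : -2 <= x <= 2 -> 0 < J a - x by move=> /andP[? ?]; lra.
(* Integration by parts: [2 * cos t / (J a - 2 * sin t) ^+ 2] is the derivative of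
   [(J a - 2 * sin t)^-1], and what remains is [2 * sin t / (J a - 2 * sin t) = J a / (J a - 2 * sin
   t) - 1]. *)
pose Phi t := 2 * (cos t * (J a - 2 * sin t)^-1) + J a / (a - a^-1) * A t - t.
have [hi hv] : has_integral sigma D (fun x => (J a - x) ^- 2)
    ((2 * pi)^-1 * (Phi (pi / 2) - Phi (- (pi / 2)))).
  apply: semicircle_has_integral.
  - move=> x /c0 h; apply: continuousV; first by rewrite gt_eqF// exprn_gt0.
    apply: (@continuous_comp _ _ _ (fun x => J a - x) (fun x => x ^+ 2)).
      by apply: continuousB; [exact: cst_continuous|exact: cvg_id].
    exact: exprn_continuous.
  - by move=> x /c0 /ltW h; rewrite invr_ge0 exprn_ge0.
  - move=> t; have hJ := Jsin_gt0 t.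
    have dI : is_derive t 1 (fun y => (J a - 2 * sin y)^-1)
        (- (J a - 2 * sin t) ^- 2 * (- (2 * cos t))).
      apply: is_derive_inv; first by rewrite gt_eqF.
      apply: is_derive_eq (is_deriveB (is_derive_cst (J a) t 1) (is_deriveZ 2 (is_derive_sin t))) _.
      by rewrite sub0r.
    have d := is_deriveB (is_deriveD (is_deriveZ 2 (is_deriveM (is_derive_cos t) dI))
      (is_deriveZ (J a / (a - a^-1)) (is_derive_A t))) (is_derive_id t 1).
    apply: is_derive_eq d _; rewrite /GRing.scale/=.
    have -> : J a / (a - a^-1) * ((a - a^-1) / (J a - 2 * sin t)) = J a / (J a - 2 * sin t).
      by rewrite mulrA divfK// gt_eqF ?a_subV.
    have -> : cos t * (- (J a - 2 * sin t) ^- 2 * - (2 * cos t)) =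
      2 * cos t ^+ 2 / (J a - 2 * sin t) ^+ 2 by ring.
    by rewrite cos2sin2; field; rewrite gt_eqF.
split=> //; rewrite hv; congr EFin; rewrite /Phi A_pihalf A_Npihalf cosN cos_pihalf !mul0r.
have p0 : pi != 0 :> R by rewrite gt_eqF// pi_gt0.
have -> : J a / (a - a^-1) = (a ^+ 2 + 1) / (a ^+ 2 - 1).
  rewrite /joukowski; field.
  by apply/andP; split; rewrite gt_eqF//; nra.
have a0 : a ^+ 2 - 1 != 0 by rewrite gt_eqF//; nra.
have -> : a ^+ 2 + 1 = (a ^+ 2 - 1) + 2 by ring.
move: (pi) (a ^+ 2 - 1) p0 a0 => p q p0 q0.
by field; rewrite p0 q0.
Qed.

End angle.
End stieltjes.

(** * The logarithmic potential and the price of moving the edge *)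

Section semicircle_potential.
Context {R : realType}.
Notation sigma := (semicircle_law R).
Notation mu := (@lebesgue_measure R).
Notation D := (`](-2), 2[%classic : set (measurableTypeR R)).
Notation J := (@joukowski R).
Implicit Types a b x t : R.

Let mD : measurable D. Proof. exact: measurable_itv. Qed.

Lemma joukowski_sub_gt0 a x : 1 <= a -> D x -> 0 < J a - x.
Proof.
by move=> a1; rewrite /= in_itv/= => /andP[_ x2]; have := joukowski_ge2 a1; lra.
Qed.

Lemma measurable_sub_id (A : set (measurableTypeR R)) (c : R) :
  measurable_fun A (fun x : R => c - x).
Proof.
apply: measurable_funTS; apply: continuous_measurable_fun => x.
by apply: continuousB; [exact: cst_continuous|exact: cvg_id].
Qed.

Lemma measurable_joukowskiV a : 1 <= a ->
  measurable_fun D (fun x : R => (J a - x)^-1).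
Proof.
move=> a1; apply: measurable_funV_gt0 => //; first exact: measurable_sub_id.
by move=> x; exact: joukowski_sub_gt0.
Qed.

(** The edge [a = 1], where the kernel is unbounded, is reached from [a > 1] by monotone
    convergence. *)
Lemma has_integral_stieltjes a : 1 <= a ->
  has_integral sigma D (fun x => (J a - x)^-1) a^-1.
Proof.
rewrite le_eqVlt => /predU1P[<-|]; last exact: has_integral_stieltjes_gt1.
(* [r n] increases to [1], so [J (r n)^-1] decreases to [J 1] and the kernels increase; as
   [harmonic 0 = 1], the factor [2^-1] keeps [r 0] positive. *)
pose r n : R := 1 - 2^-1 * harmonic n.
have h1 n : 0 < (harmonic n : R) <= 1.
  by rewrite /harmonic invr_gt0 ltr0n /= invf_le1 ?ltr0n// ler1n.
have r01 n : 0 < r n < 1.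
  by rewrite /r; have /andP[] := h1 n; lra.
have rV1 n : 1 < (r n)^-1 by rewrite invf_gt1; case/andP: (r01 n).
have rnd m n : (m <= n)%N -> r m <= r n.
  move=> mn; rewrite /r lerD2l lerN2 ler_pM2l// /harmonic.
  by rewrite lef_pV2 ?posrE ?ltr0n// ler_nat.
have rcvg : r n @[n --> \oo] --> (1 : R).
  rewrite -[X in _ --> X]subr0 -[X in _ - X](mulr0 2^-1).
  by apply: cvgB; [exact: cvg_cst|apply: cvgM; [exact: cvg_cst|exact: cvg_harmonic]].
have m1 := measurable_joukowskiV (lexx 1).
have pos x : D x -> 0 <= (J 1 - x)^-1.
  by move=> Dx; rewrite invr_ge0 ltW// joukowski_sub_gt0.
apply: ge0_has_integral => //.
pose g n x := ((J (r n)^-1 - x)^-1)%:E.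
have mg n : measurable_fun D (g n).
  by apply/measurable_EFinP; apply: measurable_joukowskiV; exact: ltW.
have g0 n x : D x -> (0 <= g n x)%E.
  by move=> Dx; rewrite lee_fin invr_ge0 ltW// joukowski_sub_gt0// ltW.
have gnd x : D x -> nondecreasing_seq (g^~ x).
  move=> Dx m n mn; rewrite lee_fin.
  have pos' k : J (r k)^-1 - x \is Num.pos by rewrite posrE joukowski_sub_gt0// ltW.
  have rpos k : r k \is Num.pos by rewrite posrE; case/andP: (r01 k).
  rewrite lef_pV2// lerD2r; apply: joukowski_le; first exact: ltW.
  by rewrite lef_pV2// rnd.
have := @cvg_monotone_convergence _ _ _ sigma D _ g mg g0 gnd.
have gI n : (\int[sigma]_(x in D) g n x = (r n)%:E)%E.
  by have [_] := has_integral_stieltjes_gt1 (rV1 n); rewrite invrK.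
rewrite (_ : (fun n => \int[sigma]_(x in D) g n x)%E = fun n => (r n)%:E); last exact/funext.
have -> : (\int[sigma]_(x in D) (limn (g^~ x)) = \int[sigma]_(x in D) ((J 1 - x)^-1)%:E)%E.
  apply: eq_integral => x /set_mem Dx; apply/cvg_lim => //.
  apply: cvg_EFin; first by apply: nearW.
  apply: cvgV; first by rewrite gt_eqF// joukowski_sub_gt0.
  apply: cvgB; last exact: cvg_cst.
  rewrite /joukowski invr1; under eq_fun do rewrite invrK.
  apply: cvgD => //; rewrite -[X in _ --> X]invr1; apply: cvgV => //.
move=> /(_ mD) H; rewrite invr1.
have H1 : (r n)%:E @[n --> \oo] --> 1%:E by apply: cvg_EFin => //; exact: nearW.
by rewrite -(cvg_lim _ H)// -(cvg_lim _ H1).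
Qed.

(** Partial fractions reduce the product to two Stieltjes transforms, except on the diagonal, where
    the squared kernel was integrated directly. *)
Lemma has_integral_stieltjesM a b : 1 <= a -> 1 <= b -> 1 < a * b ->
  has_integral sigma D (fun x => (J a - x)^-1 * (J b - x)^-1) (a * b - 1)^-1.
Proof.
move=> a1 b1 ab1; have [E|ab] := eqVneq a b.
  rewrite -E in ab1 *.
  have a1' : 1 < a by nra.
  apply: (has_integral_eq _ _ _ (has_integral_stieltjes_sqr a1')) => //.
  by move=> x _ /=; rewrite -invfM -expr2.
have Jab : J b - J a != 0.
  by rewrite subr_eq0; apply: contra ab => /eqP/joukowski_inj ->.
have := has_integralZ (J b - J a)^-1 mD
  (has_integralB mD (has_integral_stieltjes a1) (has_integral_stieltjes b1)).
apply: has_integral_eq => //.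
  move=> x /set_mem Dx /=; have A0 := joukowski_sub_gt0 a1 Dx.
  have B0 := joukowski_sub_gt0 b1 Dx.
  by field; rewrite Jab !gt_eqF.
have ba : b - a != 0 by rewrite subr_eq0 eq_sym.
have ab0 : a * b - 1 != 0 by rewrite gt_eqF// subr_gt0.
have a0 : a != 0 by rewrite gt_eqF//; lra.
have b0 : b != 0 by rewrite gt_eqF//; lra.
have -> : J b - J a = (b - a) * (a * b - 1) / (a * b).
  by rewrite joukowskiB//; [field; rewrite a0 b0|lra|lra].
by field; rewrite ba ab0 a0 b0.
Qed.

(* Up to a constant, the logarithmic potential of [sigma] at [J a] for [1 <= a]. *)
Definition logpot a := ln a + 2^-1 * a ^- 2.

(** The derivative is the Stieltjes transform [a^-1] at [J a] times the derivative of [J]. *)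
Lemma is_derive_logpot a : 0 < a -> is_derive a 1 logpot (a^-1 * (1 - a ^- 2)).
Proof.
move=> a0; have a0' : a != 0 by rewrite gt_eqF.
have d : is_derive a 1 (fun y : R => (y ^+ 2)^-1) (- (a ^+ 2) ^- 2 * (2 * a)).
  apply: is_derive_inv; first by rewrite expf_neq0.
  by apply: is_derive_eq; rewrite /GRing.scale/=; ring.
have := is_deriveD (is_derive1_ln a0) (is_deriveZ 2^-1 d).
by move/is_derive_eq; apply; rewrite /GRing.scale/=; field.
Qed.

Lemma integral_mulr_indic d (T : measurableType d) (m : {measure set T -> \bar R})
    (E : set T) (f : T -> R) : measurable E ->
  (\int[m]_x (f x * \1_E x)%:E = \int[m]_(x in E) (f x)%:E)%E.
Proof.
move=> mE; rewrite [RHS]integral_mkcond; apply: eq_integral => x _.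
by rewrite patchE indicE; case: ifPn; rewrite ?mulr1 ?mulr0.
Qed.

(* Tonelli applied to [ln ((J b - x) / (J a - x))], which is the integral of
   [(s - x)^-1] over [s] between [J a] and [J b]. *)
Lemma has_integral_logpot_lt a b : 1 <= a -> a < b ->
  has_integral sigma D (fun x => ln ((J b - x) / (J a - x))) (logpot b - logpot a).
Proof.
move=> a1 ab; have b1 : 1 <= b by lra.
have JaJb := joukowski_lt a1 ab; have Ja2 := joukowski_ge2 a1.
pose E := `[J a, J b]%classic : set (measurableTypeR R).
have mE : measurable E by exact: measurable_itv.
have ratio x : D x -> 1 <= (J b - x) / (J a - x).
  move=> Dx; rewrite ler_pdivlMr ?joukowski_sub_gt0// mul1r; lra.
apply: ge0_has_integral => //.
- apply: (measurableT_comp (@measurable_ln R)); apply: measurable_funM.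
    exact: measurable_sub_id.
  exact: measurable_joukowskiV.
- by move=> x Dx; rewrite ln_ge0// ratio.
(* [expR (- ln _)] is measurable on the whole plane and equals the inverse where [s - x] is
   positive, hence for [x] in [D] and [s] in [E]. *)
pose h (z : measurableTypeR R * measurableTypeR R) : R :=
  expR (- ln (z.2 - z.1)) * \1_E z.2 * \1_D z.1.
have mh : measurable_fun setT h.
  apply: measurable_funM; first apply: measurable_funM.
  - apply: (measurableT_comp (@measurable_expR R)); apply: measurable_funN.
    apply: (measurableT_comp (@measurable_ln R)).
    by apply: measurable_funB; [exact: measurable_snd|exact: measurable_fst].
  - by apply: measurableT_comp; [exact: measurable_indic|exact: measurable_snd].
  - by apply: measurableT_comp; [exact: measurable_indic|exact: measurable_fst].
have h0 z : (0 <= (h z)%:E)%E.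
  by rewrite lee_fin !mulr_ge0// expR_ge0.
have mh' : measurable_fun setT (EFin \o h) by exact/measurable_EFinP.
have tonelli := @fubini_tonelli _ _ _ _ R sigma mu (EFin \o h) mh' h0.
have hE x s : D x -> E s -> expR (- ln (s - x)) = (s - x)^-1.
  rewrite /E/= !in_itv/= => /andP[_ x2] /andP[s2 _].
  by rewrite expRN lnK// posrE; lra.
have inner x : D x ->
    (\int[mu]_(s in E) ((s - x)^-1)%:E = (ln ((J b - x) / (J a - x)))%:E)%E.
  move=> Dx; have ax := joukowski_sub_gt0 a1 Dx; have bx := joukowski_sub_gt0 b1 Dx.
  rewrite ln_div ?posrE//.
  have [||_ ->] // := @has_integral_FTC R (J a) (J b) (fun s => (s - x)^-1) (fun s => ln (s - x)) JaJb.
  - move=> s /andP[s1 s2]; apply: continuousV; first by rewrite gt_eqF//; lra.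
    by apply: continuousB; [exact: cvg_id|exact: cst_continuous].
  - move=> s /andP[s1 s2].
    have sx : 0 < s - x by lra.
    have ds := is_deriveB (is_derive_id s 1) (is_derive_cst x s 1).
    by apply: is_derive_eq (@is_derive_ln_comp R (fun s => s - x) s _ sx ds) _; rewrite subr0 mulr1.
transitivity (\int[sigma]_x \int[mu]_s (h (x, s))%:E)%E.
  transitivity (\int[sigma]_x (ln ((J b - x) / (J a - x)) * \1_D x)%:E)%E.
    by rewrite integral_mulr_indic.
  apply: eq_integral => x _; rewrite /h/= indicE.
  have [/set_mem Dx|nDx] := boolP (x \in D); last first.
    rewrite mulr0; under eq_integral do rewrite mulr0.
    by rewrite integral0.
  rewrite mulr1 -inner// -(integral_mulr_indic _ _ mE).
  apply: eq_integral => s _; rewrite mulr1 indicE.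
  by have [/set_mem Es|_] := boolP (s \in E); rewrite ?mulr0// hE.
rewrite [LHS]tonelli.
(* The Stieltjes transform at [s], in a form visibly continuous in [s], as the substitution
   [s = J t] requires. *)
pose kappa s : R := (s - Num.sqrt (s ^+ 2 - 4)) / 2.
have kappaJ t : 1 <= t -> kappa (J t) = t^-1.
  move=> t1; rewrite /kappa.
  have -> : J t ^+ 2 - 4 = (t - t^-1) ^+ 2.
    by rewrite /joukowski; field; rewrite gt_eqF//; lra.
  rewrite sqrtr_sqr ger0_norm; last first.
    rewrite subr_ge0 (le_trans _ t1)// invf_le1//; lra.
  by rewrite /joukowski; lra.
transitivity (\int[mu]_(s in E) (kappa s)%:E)%E.
  rewrite -integral_mulr_indic//; apply: eq_integral => s _.
  have [/set_mem Es|nEs] := boolP (s \in E); last first.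
    rewrite /h indicE (negbTE nEs) mulr0.
    under eq_integral => x _ do rewrite /= indicE (negbTE nEs) mulr0 mul0r.
    by rewrite integral0.
  rewrite indicE mem_set// mulr1.
  have [t t1 tE] : exists2 t, 1 <= t & J t = s.
    by apply: joukowski_surj; move: Es; rewrite /E/= in_itv/= => /andP[]; lra.
  rewrite -tE kappaJ//; have [_ <-] := has_integral_stieltjes t1.
  rewrite -integral_mulr_indic//; apply: eq_integral => x _.
  rewrite /h /= [\1_E _]indicE tE mem_set// mulr1 indicE.
  by have [/set_mem Dx|_] := boolP (x \in D); rewrite ?mulr0// hE.
have incr : {in `[a, b] &, {homo J : x y / x < y}}.
  by move=> x y /[!in_itv]/= /andP[ax _] _; apply: joukowski_lt; lra.
have dJ : forall x, a <= x <= b -> is_derive x 1 J (1 - x ^- 2).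
  by move=> x /andP[ax _]; apply: is_derive_joukowski; lra.
have cJ : forall x, a <= x <= b -> {for x, continuous (fun t => 1 - t ^- 2 : R)}.
  move=> x /andP[ax _]; apply: continuousB; first exact: cst_continuous.
  by apply: continuousV; [rewrite expf_neq0// gt_eqF//; lra|exact: exprn_continuous].
have cG : {within `[J a, J b], continuous kappa}.
  apply: continuous_at_within => s _; apply: continuousM; last exact: cst_continuous.
  apply: continuousB; first exact: cvg_id.
  apply: (@continuous_comp _ _ _ (fun s : R => s ^+ 2 - 4) Num.sqrt); last exact: sqrt_continuous.
  by apply: continuousB; [exact: exprn_continuous|exact: cst_continuous].
rewrite (substitution_segment ab incr dJ cJ cG).
transitivity (\int[mu]_(t in `[a, b]) (t^-1 * (1 - t ^- 2))%:E)%E.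
  apply: eq_integral => t /set_mem/= /[!in_itv]/= /andP[ta _].
  by rewrite kappaJ//; lra.
have [||_ ->] // := @has_integral_FTC R a b (fun t => t^-1 * (1 - t ^- 2)) logpot ab.
- move=> t /andP[ta _]; have t0 : t != 0 by rewrite gt_eqF//; lra.
  have cV : {for t, continuous (fun y : R => y^-1)} by apply: continuousV => //; exact: cvg_id.
  apply: continuousM => //; apply: continuousB; first exact: cst_continuous.
  by apply: continuousV; [rewrite expf_neq0|exact: exprn_continuous].
- by move=> t /andP[ta _]; apply: is_derive_logpot; lra.
Qed.

Lemma has_integral_logpot a b : 1 <= a -> 1 <= b ->
  has_integral sigma D (fun x => ln ((J b - x) / (J a - x))) (logpot b - logpot a).
Proof.
move=> a1 b1; have [ab|ba|E] := ltgtP a b.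
- exact: has_integral_logpot_lt.
- apply: (has_integral_eq _ _ _ (has_integralZ (-1) mD (has_integral_logpot_lt b1 ba))) => //.
    move=> x /set_mem Dx /=; rewrite mulN1r -lnV ?invf_div// posrE.
    by rewrite divr_gt0 ?joukowski_sub_gt0.
  by ring.
- rewrite E subrr; apply: (has_integral_eq _ _ _ (has_integral_cst 0)) => //.
  by move=> x /set_mem Dx /=; rewrite divff ?ln1// gt_eqF// joukowski_sub_gt0.
Qed.

(** This is [I_e] at [J p]: under [u = J t] its integrand becomes [2^-1 * (t - t^-1)]. *)
Definition edge_cost (p : R) : R := 4^-1 * p ^+ 2 - 4^-1 * p ^- 2 - ln p.

Lemma is_derive_edge_cost (p : R) : 0 < p ->
  is_derive p 1 edge_cost (2^-1 * (p - p^-1) * (1 - p ^- 2)).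
Proof.
move=> p0; have p0' : p != 0 by rewrite gt_eqF.
have d : is_derive p 1 (fun y : R => (y ^+ 2)^-1) (- (p ^+ 2) ^- 2 * (2 * p)).
  apply: is_derive_inv; first by rewrite expf_neq0.
  by apply: is_derive_eq; rewrite /GRing.scale/=; ring.
have d2 : is_derive p 1 (fun y : R => y ^+ 2) (2 * p).
  by apply: is_derive_eq; rewrite /GRing.scale/=; ring.
have := is_deriveB (is_deriveB (is_deriveZ 4^-1 d2) (is_deriveZ 4^-1 d)) (is_derive1_ln p0).
by move/is_derive_eq; apply; rewrite /GRing.scale/=; field.
Qed.

Lemma edge_cost1 : edge_cost 1 = 0.
Proof. by rewrite /edge_cost ln1 expr1n invr1; lra. Qed.

Lemma I_e_joukowski (p : R) : 1 <= p -> I_e (J p) = (edge_cost p)%:E.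
Proof.
rewrite le_eqVlt => /predU1P[<-|p1].
  by rewrite /I_e joukowski1 edge_cost1 set_itv1 integral_set1.
transitivity (\int[mu]_(u in `[J 1, J p]) (Num.sqrt ((u / 2) ^+ 2 - 1))%:E)%E.
  by rewrite joukowski1.
have incr : {in `[1%R : R, p] &, {homo J : x y / x < y}}.
  by move=> x y /[!in_itv]/= /andP[ax _] _; apply: joukowski_lt; lra.
have dJ : forall x, 1 <= x <= p -> is_derive x 1 J (1 - x ^- 2).
  by move=> x /andP[ax _]; apply: is_derive_joukowski; lra.
have cJ : forall x, 1 <= x <= p -> {for x, continuous (fun t => 1 - t ^- 2 : R)}.
  move=> x /andP[ax _]; apply: continuousB; first exact: cst_continuous.
  by apply: continuousV; [rewrite expf_neq0// gt_eqF//; lra|exact: exprn_continuous].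
have cG : {within `[J 1, J p], continuous (fun u : R => Num.sqrt ((u / 2) ^+ 2 - 1))}.
  apply: continuous_at_within => s _.
  apply: (@continuous_comp _ _ _ (fun s : R => (s / 2) ^+ 2 - 1) Num.sqrt); last exact: sqrt_continuous.
  apply: continuousB; last exact: cst_continuous.
  apply: (@continuous_comp _ _ _ (fun s : R => s / 2) (fun s => s ^+ 2)); last exact: exprn_continuous.
  by apply: continuousM; [exact: cvg_id|exact: cst_continuous].
rewrite (substitution_segment p1 incr dJ cJ cG).
transitivity (\int[mu]_(t in `[(1%R : R), p]) (2^-1 * (t - t^-1) * (1 - t ^- 2))%:E)%E.
  apply: eq_integral => t /set_mem/= /[!in_itv]/= /andP[t1 _]; congr (_ * _)%:E.
  have -> : (J t / 2) ^+ 2 - 1 = (2^-1 * (t - t^-1)) ^+ 2.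
    by rewrite /joukowski; field; rewrite gt_eqF//; lra.
  rewrite sqrtr_sqr ger0_norm// mulr_ge0//.
  by rewrite subr_ge0 (le_trans _ t1)// invf_le1//; lra.
have cf : forall t, 1 <= t <= p ->
    {for t, continuous (fun t => 2^-1 * (t - t^-1) * (1 - t ^- 2) : R)}.
  move=> t /andP[ta _]; have t0 : t != 0 by rewrite gt_eqF//; lra.
  have cV : {for t, continuous (fun y : R => y^-1)} by apply: continuousV => //; exact: cvg_id.
  apply: continuousM.
    apply: continuousM; first exact: cst_continuous.
    by apply: continuousB => //; exact: cvg_id.
  apply: continuousB; first exact: cst_continuous.
  by apply: continuousV; [rewrite expf_neq0|exact: exprn_continuous].
have dF : forall t, 1 <= t <= p -> is_derive t 1 edge_cost (2^-1 * (t - t^-1) * (1 - t ^- 2)).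
  by move=> t /andP[ta _]; apply: is_derive_edge_cost; lra.
by have [_ ->] := has_integral_FTC p1 cf dF; rewrite edge_cost1 subr0.
Qed.

End semicircle_potential.

(** * Relative entropy *)

Section tilted_measure.
Context d (T : measurableType d) (R : realType).
Variables (mu : {finite_measure set T -> \bar R}) (k : T -> R).
Hypotheses (mk : measurable_fun setT k) (k0 : forall x, 0 <= k x).
Hypothesis ki : mu.-integrable setT (EFin \o k).
Variables (c : {nonneg R}) (z : T).

(** The proofs are arguments of the definition so that the measure structure can be declared on it;
    [tilted] likewise takes the integrability proof on which its finiteness rests. *)
Definition weighted of measurable_fun setT k & (forall x, 0 <= k x) : set T -> \bar R :=
  fun A => (\int[mu]_(x in A) (k x)%:E)%E.
Local Notation W := (weighted mk k0).

Let W0 : W set0 = 0%E. Proof. by rewrite /weighted integral_set0. Qed.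

Let W_ge0 A : (0 <= W A)%E.
Proof. by apply: integral_ge0 => x _; rewrite lee_fin. Qed.

Let W_sigma_additive : semi_sigma_additive W.
Proof.
move=> /= F mF tF mUF; rewrite /weighted; apply: cvg_toP.
  apply: ereal_nondecreasing_is_cvgn => m n mn.
  by apply: lee_sum_nneg_natr => // i _ _; exact: W_ge0.
rewrite ge0_integral_bigcup//=.
- by apply/measurable_EFinP; exact: measurable_funTS.
- by move=> x _; rewrite lee_fin.
Qed.

HB.instance Definition _ := isMeasure.Build _ _ _ W W0 W_ge0 W_sigma_additive.

Definition tilted of mu.-integrable setT (EFin \o k) : set T -> \bar R :=
  measure_add W (mscale c (dirac z)).
Local Notation V := (tilted ki).

HB.instance Definition _ := Measure.on V.

Lemma tiltedE A : V A = (\int[mu]_(x in A) (k x)%:E + c%:num%:E * \d_z A)%E.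
Proof. by rewrite /tilted measure_addE. Qed.

Let W_fin A : measurable A -> W A \is a fin_num.
Proof.
move=> mA; apply: integrable_fin_num => //.
exact: integrableS ki.
Qed.

Let V_fin : fin_num_fun V.
Proof.
by move=> A mA; rewrite tiltedE fin_numD W_fin//= fin_numM.
Qed.

HB.instance Definition _ := @Measure_isFinite.Build _ _ _ V V_fin.

Lemma ge0_integral_tilted E (f : T -> \bar R) : measurable E -> measurable_fun E f ->
  (forall x, E x -> (0 <= f x)%E) ->
  (\int[V]_(x in E) f x =
   \int[mu]_(x in E) (f x * (k x)%:E) + c%:num%:E * (\d_z E * f z))%E.
Proof.
move=> mE mf f0; rewrite /tilted ge0_integral_measure_add//; congr (_ + _)%E.
  (* [W] is registered only as a measure; a finite measure is packed locally so that the density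
     formula applies. *)
  have Wfin : fin_num_fun W by exact: W_fin.
  pose H := @Measure_isFinite.Build _ _ _ W Wfin.
  pose W' : {finite_measure set T -> \bar R} := HB.pack W H.
  by rewrite -(@ge0_integral_density _ _ _ mu W' k mk k0 (fun _ _ => erefl)).
by rewrite ge0_integral_mscale// integral_dirac.
Qed.

End tilted_measure.

Section entropy_representation.
Context {R : realType}.
Local Notation borel := (measurableTypeR R).
Local Open Scope ereal_scope.
Local Open Scope charge_scope.

(** The derivative in [H] is replaced by a version that is finite and nonnegative everywhere. The
    two agree [nu]-almost everywhere, hence [mu]-almost everywhere by domination. *)
Lemma relative_entropyE (mu : probability borel R)
    (nu : {finite_measure set borel -> \bar R}) : mu `<< nu ->
  exists g : R -> R, [/\ measurable_fun setT g, (forall x, 0 <= g x)%R,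
    (forall A, measurable A -> mu A = \int[nu]_(x in A) (g x)%:E) &
    H mu nu = \int[mu]_x (ln (g x))%:E + nu setT - 1].
Proof.
move=> dom; pose f := Radon_Nikodym_SigmaFinite.f mu nu.
have fi : nu.-integrable setT f by exact: Radon_Nikodym_SigmaFinite.f_integrable.
have mf : measurable_fun setT f by exact: measurable_int fi.
have ffin x : f x \is a fin_num by exact: Radon_Nikodym_SigmaFinite.f_fin_num.
have mg : measurable_fun setT (fine \o f) by exact: (measurableT_comp (fine_measurable measurableT)).
exists (fine \o f); split => //.
- by move=> x; rewrite fine_ge0// Radon_Nikodym_SigmaFinite.f_ge0.
- move=> A mA; rewrite (Radon_Nikodym_SigmaFinite.f_integral dom)//.
  by apply: eq_integral => x _; rewrite /= fineK.
- rewrite /H asboolT//; congr (_ + _ - _).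
  have md : measurable_fun setT (fine \o ('d (charge_of_finite_measure mu) '/d nu)).
    by apply: (measurableT_comp (fine_measurable measurableT)).
  have mln : measurable_fun setT (@ln R) by exact: measurable_ln.
  apply: ae_eq_integral => //.
  + by apply/measurable_EFinP; exact: (measurableT_comp mln md).
  + by apply/measurable_EFinP; exact: (measurableT_comp mln mg).
  apply: (null_dominates_ae_eq measurableT dom).
  have := ae_eq_Radon_Nikodym_SigmaFinite dom measurableT.
  by apply: filterS => x fx _; rewrite -fx.
Qed.

End entropy_representation.

Lemma ln_le_sub1 (R : realType) (x : R) : 0 < x -> ln x <= x - 1.
Proof.
move=> x0; have -> : x = 1 + (x - 1) by ring.
by apply: (le_trans (le_ln1Dx _)); lra.
Qed.

Section entropy_bounds.
Context {R : realType}.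
Local Notation borel := (measurableTypeR R).
Notation sigma := (semicircle_law R).
Notation D := (`](-2), 2[%classic : set (measurableTypeR R)).

Let mD : measurable D. Proof. exact: measurable_itv. Qed.

(** The law [sigma] does not charge the zero set of its own density [g], so integrals can be moved
    to a set where [ln (g x)] and [(g x)^-1] are meaningful. *)
Let positive_density (nu : {finite_measure set borel -> \bar R}) (g : R -> R) :
  measurable_fun setT g ->
  (forall A, measurable A -> sigma A = \int[nu]_(x in A) (g x)%:E)%E ->
  let U := D `&` [set x | 0 < g x] in
  [/\ measurable U, sigma (~` U) = 0%E & sigma U = 1%E].
Proof.
move=> mg gE U.
have mU : measurable U.
  by rewrite /U -[X in _ `&` X]setTI; apply: measurableI => //; rewrite setTI -[X in measurable X]setTI;
    exact: measurable_fun_ltr.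
have U0 : sigma (~` U) = 0%E.
  pose N := D `&` ~` U.
  have mN : measurable N by apply: measurableI => //; exact: measurableC.
  have N0 : sigma N = 0%E.
    apply/eqP; rewrite eq_le measure_ge0 andbT gE//.
    have -> : (0 = \int[nu]_(x in N) cst 0 x)%E by rewrite integral0.
    apply: le_integral_measurable => //.
      by apply/measurable_EFinP; exact: measurable_funTS.
    move=> x [Dx nUx]; rewrite lee_fin leNgt; apply/negP => gx.
    by apply: nUx; split.
  apply/eqP; rewrite eq_le measure_ge0 andbT.
  have DN : ~` U `<=` ~` D `|` N.
    by move=> x nUx; have [Dx|] := pselect (D x); [right|left].
  apply: (@le_trans _ _ (sigma (~` D `|` N))).
    by apply: le_measure => //; rewrite inE; [exact: measurableC|apply: measurableU => //; exact: measurableC].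
  have E0 : (sigma (~` D) + sigma N <= 0)%E by rewrite N0 semicircle_setC adde0.
  by apply: le_trans E0; apply: measureU2 => //; exact: measurableC.
split=> //.
have : sigma setT = 1%E by exact: probability_setT.
rewrite -(setUv U) measureU//; [|exact: measurableC|exact: setICr].
by rewrite [X in (_ + X)%E](_ : _ = 0%E) ?adde0//; exact: U0.
Qed.

Let has_integral_restrict U f v : measurable U -> U `<=` D -> sigma (~` U) = 0%E ->
  has_integral sigma D f v -> has_integral sigma U f v.
Proof.
move=> mU UD U0 [fi fv]; split; first exact: integrableS fi.
have mC : measurable (~` U) by exact: measurableC.
rewrite -fv (negligible_integral mC mD fi U0); congr integral.
by rewrite setDE setCK; apply/seteqP; split => [x Ux|x []//]; split => //; exact: UD.
Qed.

(* Gibbs' inequality with the test function [w]: integrate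
   [ln (w / g) <= w / g - 1], where [g] is the density of [sigma]. *)
Lemma entropy_ge (nu : {finite_measure set borel -> \bar R}) (E : set borel)
    (w : R -> R) (L W : R) :
  measurable E -> D `<=` E ->
  (forall x, E x -> 0 <= w x) -> (forall x, D x -> 0 < w x) ->
  has_integral sigma D (fun x => ln (w x)) L -> has_integral nu E w W ->
  ((L - W)%:E + nu setT <= H sigma nu)%E.
Proof.
move=> mE DE w0 w1 hL [wi wv].
have [dom|ndom] := pselect (sigma `<< nu); last by rewrite /H asboolF// leey.
have [g [mg g0 gE ->]] := relative_entropyE dom.
have [mU U0 U1] := positive_density mg gE; set U := D `&` _ in mU U0 U1.
have UD : U `<=` D by move=> x [].
have UE : U `<=` E by move=> x [/DE].
have nuT : nu setT \is a fin_num by exact: fin_num_measure.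
have mw : measurable_fun U w.
  by apply: (measurable_funS mE UE); apply/measurable_EFinP; exact: measurable_int wi.
have mgU : measurable_fun U g by exact: measurable_funTS.
have gU x : U x -> 0 < g x by move=> [].
have mwg : measurable_fun U (fun x => w x / g x).
  by apply: measurable_funM => //; exact: measurable_funV_gt0.
have wUi : nu.-integrable U (EFin \o w) by exact: integrableS wi.
have [W' hW'] : exists W', has_integral nu U w W'.
  by eexists; exact: integrable_has_integral wUi.
have W'W : W' <= W.
  rewrite -lee_fin -hW'.2 -wv; apply: ge0_subset_integral => //.
  by apply: measurable_int wi.
(* Since [sigma = g nu], the quotient [w / g] integrates to the [nu]-integral of [w] over [U], which
   is at most [W]. *)
have hwg : has_integral sigma U (fun x => w x / g x) W'.
  apply: ge0_has_integral => //.
    by move=> x Ux; rewrite divr_ge0//; apply: w0; exact: UE.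
  rewrite (@ge0_integral_density _ _ _ nu sigma g)//; last 2 first.
  - exact/measurable_EFinP.
  - by move=> x Ux; rewrite lee_fin divr_ge0//; apply: w0; exact: UE.
  rewrite -hW'.2; apply: eq_integral => x /set_mem Ux.
  by rewrite -EFinM divfK// gt_eqF// gU.
have h1 : has_integral sigma U (cst 1) 1.
  exact: has_integral_restrict (has_integral_cst 1).
have hh := has_integralB mU (has_integralD mU (has_integral_restrict mU UD U0 hL) h1) hwg.
have lnm : measurable_fun U (fun x => (ln (g x))%:E).
  apply/measurable_EFinP; apply: measurable_funTS.
  exact: (measurableT_comp (@measurable_ln R)).
have -> : (\int[sigma]_x (ln (g x))%:E = \int[sigma]_(x in U) (ln (g x))%:E)%E.
  have mC : measurable (~` U) by exact: measurableC.
  rewrite (integral_setDnull measurableT mC _ U0); last first.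
    by apply/measurable_EFinP; exact: (measurableT_comp (@measurable_ln R)).
  by rewrite setDE setCK setTI.
have key : ((L + 1 - W')%:E <= \int[sigma]_(x in U) (ln (g x))%:E)%E.
  rewrite -hh.2; apply: le_integral_measurable => //.
    exact: measurable_int hh.1.
  move=> x Ux; rewrite lee_fin /=.
  have gx := gU _ Ux; have wx := w1 _ (UD _ Ux).
  have := ln_le_sub1 (divr_gt0 wx gx); rewrite ln_div ?posrE//; lra.
rewrite -(fineK nuT).
apply: (@le_trans _ _ ((L + 1 - W')%:E + (fine (nu setT))%:E - 1)%E).
  by rewrite -[1%E]/(1%:E) -!EFinD lee_fin; lra.
by rewrite leeB// leeD.
Qed.

(* Only [k sigma <= nu] is needed: [ln (g k) <= g k - 1] makes it unnecessary to
   identify the density [g] of [sigma] with respect to [nu]. *)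
Lemma entropy_le (nu : {finite_measure set borel -> \bar R}) (k : R -> R) (L : R) :
  measurable_fun setT k -> (forall x, 0 <= k x) -> (forall x, D x -> 0 < k x) ->
  has_integral sigma D (fun x => ln (k x)) L ->
  (forall E f, measurable E -> measurable_fun E f -> (forall x, E x -> 0 <= f x)%E ->
     \int[sigma]_(x in E) (f x * (k x)%:E) <= \int[nu]_(x in E) f x)%E ->
  (H sigma nu <= nu setT - (1 + L)%:E)%E.
Proof.
move=> mk k0 k1 hL knu.
(* On a [nu]-null set [k] integrates to [0] against [sigma], while [k] is positive on [D], which
   carries [sigma]. *)
have dom : sigma `<< nu.
  apply/null_content_dominatesP => A mA nuA.
  have mAD : measurable (A `&` D) by exact: measurableI.
  have mkA : measurable_fun (A `&` D) (fun x => (k x)%:E).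
    by apply/measurable_EFinP; exact: measurable_funTS.
  have I0 : (\int[sigma]_(x in A `&` D) `|(k x)%:E| = 0)%E.
    under eq_integral do rewrite gee0_abs ?lee_fin//.
    apply/eqP; rewrite eq_le integral_ge0 ?andbT; last by move=> x _; rewrite lee_fin.
    have -> : (\int[sigma]_(x in A `&` D) (k x)%:E =
        \int[sigma]_(x in A `&` D) (cst 1 x * (k x)%:E))%E.
      by apply: eq_integral => x _; rewrite /= mul1e.
    apply: (le_trans (knu _ (cst 1%E) mAD _ _)) => //.
    rewrite integral_cst// mul1e -nuA.
    by apply: le_measure; rewrite ?inE// => x [].
  have /(ae_eq_integral_abs _ mAD mkA) [N [mN N0 sN]] := I0.
  have AN : A `<=` ~` D `|` N.
    move=> x Ax; have [Dx|] := pselect (D x); [right|by left].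
    apply: sN => /= /(_ (conj Ax Dx)) [kx].
    by have := k1 _ Dx; rewrite kx ltxx.
  apply/eqP; rewrite eq_le measure_ge0 andbT.
  apply: (@le_trans _ _ (sigma (~` D `|` N))).
    by apply: le_measure => //; rewrite inE//; apply: measurableU => //; exact: measurableC.
  have E0 : (sigma (~` D) + sigma N <= 0)%E by rewrite N0 semicircle_setC adde0.
  by apply: le_trans E0; apply: measureU2 => //; exact: measurableC.
have [g [mg g0 gE ->]] := relative_entropyE dom.
have [mU U0 U1] := positive_density mg gE; set U := D `&` _ in mU U0 U1.
have UD : U `<=` D by move=> x [].
have gU x : U x -> 0 < g x by move=> [].
have mgk : measurable_fun U (fun x => g x * k x).
  by apply: measurable_funTS; exact: measurable_funM.
have gk0 x : 0 <= g x * k x by rewrite mulr_ge0.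
(* Testing [k sigma <= nu] on [g] bounds this by the [nu]-integral of [g] over [U], that is by
   [sigma U = 1]. *)
have gk1 : (\int[sigma]_(x in U) (g x * k x)%:E <= 1)%E.
  rewrite -U1 gE//; apply: (knu U (fun x => (g x)%:E)) => //.
    by apply/measurable_EFinP; exact: measurable_funTS.
  by move=> x _; rewrite lee_fin.
have gkfin : (\int[sigma]_(x in U) (g x * k x)%:E)%E \is a fin_num.
  rewrite ge0_fin_numE; first exact: le_lt_trans gk1 (ltry _).
  by apply: integral_ge0 => x _; rewrite lee_fin.
have [G hG] : exists G, has_integral sigma U (fun x => g x * k x) G.
  exists (fine (\int[sigma]_(x in U) (g x * k x)%:E)%E).
  by apply: ge0_has_integral => //; rewrite fineK.
have G1 : G <= 1 by rewrite -lee_fin -hG.2.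
have h1 : has_integral sigma U (cst 1) 1.
  exact: has_integral_restrict (has_integral_cst 1).
have hh := has_integralB mU (has_integralB mU hG h1) (has_integral_restrict mU UD U0 hL).
have -> : (\int[sigma]_x (ln (g x))%:E = \int[sigma]_(x in U) (ln (g x))%:E)%E.
  have mC : measurable (~` U) by exact: measurableC.
  rewrite (integral_setDnull measurableT mC _ U0); last first.
    by apply/measurable_EFinP; exact: (measurableT_comp (@measurable_ln R)).
  by rewrite setDE setCK setTI.
have key : (\int[sigma]_(x in U) (ln (g x))%:E <= (G - 1 - L)%:E)%E.
  rewrite -hh.2; apply: le_integral_measurable => //.
  - apply/measurable_EFinP; apply: measurable_funTS.
    exact: (measurableT_comp (@measurable_ln R)).
  - exact: measurable_int hh.1.
  move=> x Ux; rewrite lee_fin /=.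
  have gx := gU _ Ux; have kx := k1 _ (UD _ Ux).
  have := ln_le_sub1 (mulr_gt0 gx kx); rewrite lnM ?posrE//; lra.
have nuT : nu setT \is a fin_num by exact: fin_num_measure.
rewrite -(fineK nuT).
apply: (@le_trans _ _ ((G - 1 - L)%:E + (fine (nu setT))%:E - 1)%E).
  by rewrite leeB// leeD.
by rewrite -[1%E]/(1%:E) -!EFinD lee_fin; lra.
Qed.

End entropy_bounds.

(** * Bounds on the rate functions *)

Section rate_function_bounds.
Context {R : realType}.
Local Notation borel := (measurableTypeR R).
Notation sigma := (semicircle_law R).
Notation D := (`](-2), 2[%classic : set borel).
Notation J := (@joukowski R).
Implicit Types (m psi theta Gamma a b t c : R) (nu : {finite_measure set borel -> \bar R}).

Let mD : measurable D. Proof. exact: measurable_itv. Qed.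

(* The dual lower bound given by the test function [(J t - x) / (J a - x)]. *)
Definition Phi Gamma a t m : R :=
  2^-1 * (logpot t - logpot a + (J a - J t) * (2 * m - J a) / Gamma).

Section variational_problem.
Variables (Gamma psi m : R) (nu : {finite_measure set borel -> \bar R}).
Hypotheses (Gamma0 : 0 < Gamma) (psi2 : 2 <= psi).
Hypotheses (nuE : M_plus `[- psi, psi] nu) (mF : m%:E = F psi nu Gamma).

Let E := `[- psi, psi]%classic : set borel.
Let mE : measurable E. Proof. exact: measurable_itv. Qed.
Let n := fine (nu setT).
Let V theta := fine (\int[nu]_(x in E) ((theta - x)^-1)%:E)%E.

Let DE : D `<=` E.
Proof.
have psi2' := psi2.
by move=> x; rewrite /E/= !in_itv/= => /andP[? ?]; apply/andP; split; lra.
Qed.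

Let has_integral_V theta : psi < theta ->
  has_integral nu E (fun x => (theta - x)^-1) (V theta).
Proof.
move=> th; apply: integrable_has_integral => //.
have pos x : E x -> 0 < theta - x.
  by rewrite /E/= in_itv/= => /andP[_ ?]; lra.
apply: (@bounded_integrable _ _ _ _ _ _ (theta - psi)^-1) => //.
- by rewrite ltey_eq fin_num_measure.
- by apply: measurable_funV_gt0 => //; exact: measurable_sub_id.
- move=> x Ex; have xp := pos x Ex.
  rewrite ger0_norm; last by rewrite invr_ge0 ltW.
  have tp : 0 < theta - psi by lra.
  rewrite lef_pV2 ?posrE//.
  by move: Ex; rewrite /E/= in_itv/= => /andP[_ ?]; lra.
Qed.

Let has_integral_1 : has_integral nu E (cst 1) n.
Proof.
apply: ge0_has_integral => //.
transitivity (\int[nu]_(x in E) (cst 1%:E x))%E => //.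
rewrite integral_cst// mul1e /n fineK ?fin_num_measure//.
rewrite -(setUv E) measureU//; [|exact: measurableC|exact: setICr].
by rewrite [X in (_ + X)%E](_ : _ = 0%E) ?adde0.
Qed.

Let integral_Nyc theta : psi < theta ->
  (\int[nu]_(x in `]-oo, psi]) ((theta - x)^-1)%:E = (V theta)%:E)%E.
Proof.
move=> th; rewrite -(has_integral_V th).2.
have mC : measurable (~` E) by exact: measurableC.
have m1 : measurable (`]-oo, psi]%classic : set borel) by exact: measurable_itv.
rewrite (integral_setDnull m1 mC _ nuE); last first.
  apply/measurable_EFinP; apply: measurable_funV_gt0 => //.
    exact: measurable_sub_id.
  by move=> x; rewrite /= in_itv/=; lra.
congr integral; rewrite setDE setCK; apply/seteqP; split => [x []//|x Ex]; split => //.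
by move: Ex; rewrite /E/= !in_itv/= => /andP[].
Qed.

Let infE : ereal_inf [set (theta%:E + Gamma%:E *
    \int[nu]_(x in `]-oo, psi]) ((theta - x)^-1)%:E)%E
    | theta in [set theta | psi < theta]] = (2 * m)%:E.
Proof. by rewrite EFinM mF /F muleA -EFinM divff ?mul1e. Qed.

Let functional_ge theta : psi < theta -> 2 * m <= theta + Gamma * V theta.
Proof.
move=> th; rewrite -lee_fin -infE; apply: ereal_inf_lbound; exists theta => //.
by rewrite integral_Nyc.
Qed.

Let functional_approx (e : R) : 0 < e ->
  exists2 theta, psi < theta & theta + Gamma * V theta < 2 * m + e.
Proof.
move=> e0; have := infE; set S := [set _ | _ in _] => SE.
have Sfin : ereal_inf S \is a fin_num by rewrite SE.
have [_ [theta th <-]] := lb_ereal_inf_adherent e0 Sfin.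
rewrite SE integral_Nyc// -EFinM -!EFinD lte_fin => h.
by exists theta.
Qed.

Let nu_fin : nu setT = n%:E.
Proof. by rewrite /n fineK// fin_num_measure. Qed.

(** As [t <= a], the test function is [1] minus a nonnegative multiple of [(J a - x)^-1]. Only a
    lower bound on the integral of this kernel is needed, and the infimum in [F] gives one at
    [theta = J a]. The condition [psi <= J t] keeps the test function nonnegative. *)
Lemma half_entropy_ge_hi a t : 1 <= t -> t <= a -> psi <= J t -> psi < J a ->
  ((Phi Gamma a t m)%:E <= 2^-1%:E * H sigma nu)%E.
Proof.
move=> t1 ta psit psia; have a1 : 1 <= a by lra.
have G0 := Gamma0; have p2 := psi2.
have JtJa := joukowski_le t1 ta.
have posa x : E x -> 0 < J a - x by rewrite /E/= in_itv/= => /andP[_ ?]; lra.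
pose w x := (J t - x) / (J a - x).
have hw : has_integral nu E w (n - (J a - J t) * V (J a)).
  apply: (has_integral_eq _ _ _ (has_integralB mE has_integral_1
    (has_integralZ (J a - J t) mE (has_integral_V psia)))) => //.
  by move=> x /set_mem /posa xa; rewrite /w /=; field; rewrite gt_eqF.
have w0 x : E x -> 0 <= w x.
  move=> Ex; apply: divr_ge0; last exact/ltW/posa.
  by move: Ex; rewrite /E/= in_itv/= => /andP[_ ?]; lra.
have w1 x : D x -> 0 < w x.
  by move=> Dx; rewrite divr_gt0 ?joukowski_sub_gt0.
have := entropy_ge mE DE w0 w1 (has_integral_logpot a1 t1) hw.
rewrite nu_fin -EFinD => Hge; rewrite /Phi EFinM lee_pmul2l// ?lte_fin//.
apply: le_trans Hge; rewrite lee_fin.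
have VJ := functional_ge psia.
have KV : (2 * m - J a) / Gamma <= V (J a) by rewrite ler_pdivrMr//; lra.
have : (J a - J t) * ((2 * m - J a) / Gamma) <= (J a - J t) * V (J a).
  by apply: ler_wpM2l => //; lra.
by rewrite mulrA; lra.
Qed.

(* [y |-> ln ((y + k) / y)] is convex and thus above its tangent at [y0]. *)
Lemma ln_ratio_tangent (y y0 k : R) : 0 < y -> 0 < y0 -> 0 <= k ->
  ln ((y0 + k) / y0) - (y - y0) * (k * (y0^-1 * (y0 + k)^-1)) <= ln ((y + k) / y).
Proof.
move=> yp y0p k0; have ykp : 0 < y + k by lra.
have y0kp : 0 < y0 + k by lra.
have zp : 0 < ((y0 + k) / y0) / ((y + k) / y) by rewrite !divr_gt0.
have := ln_le_sub1 zp.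
rewrite [ln (_ / ((y + k) / y))]ln_div ?posrE ?divr_gt0//.
suff : (y0 + k) / y0 / ((y + k) / y) - 1 <= (y - y0) * (k * (y0^-1 * (y0 + k)^-1)) by lra.
rewrite -subr_ge0.
have -> : (y - y0) * (k * (y0^-1 * (y0 + k)^-1)) - ((y0 + k) / y0 / ((y + k) / y) - 1) =
  k * (y - y0) ^+ 2 / (y0 * (y0 + k) * (y + k)).
  by field; rewrite !gt_eqF.
apply: divr_ge0; first by rewrite mulr_ge0// sqr_ge0.
by rewrite ltW// !mulr_gt0.
Qed.

(* The near-minimizer [theta] of [F] is unknown, so the test function is
   [(theta + k - x) / (theta - x)] with [k = J b - J a], and convexity in [theta]
   brings it back to [theta = J a]. *)
Lemma half_entropy_ge_lo a b : 1 <= a -> a <= b -> 1 < a * b ->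
  a * b - 1 = Gamma \/ a = 1 /\ Gamma <= a * b - 1 ->
  ((Phi Gamma a b m)%:E <= 2^-1%:E * H sigma nu)%E.
Proof.
move=> a1 ab ab1 crit; have b1 : 1 <= b by lra.
have G0 := Gamma0; have p2 := psi2.
set k := J b - J a.
have k0 : 0 <= k by rewrite subr_ge0 joukowski_le.
apply/lee_addgt0Pr => e e0.
(* Chosen so that [k * (e' / Gamma) <= e], also when [k = 0]. *)
pose e' := e * Gamma / (k + 1).
have e'0 : 0 < e' by rewrite /e' divr_gt0 ?mulr_gt0//; lra.
have [theta th VJ] := functional_approx e'0.
have pos x : E x -> 0 < theta - x by rewrite /E/= in_itv/= => /andP[_ ?]; lra.
have [s s1 sE] : exists2 s, 1 <= s & J s = theta by apply: joukowski_surj; lra.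
have [s' s'1 s'E] : exists2 s, 1 <= s & J s = theta + k by apply: joukowski_surj; lra.
pose w x := (J s' - x) / (J s - x).
have hw : has_integral nu E w (n + k * V theta).
  apply: (has_integral_eq _ _ _ (has_integralD mE has_integral_1
    (has_integralZ k mE (has_integral_V th)))) => //.
  by move=> x /set_mem /pos xa; rewrite /w sE s'E /=; field; rewrite gt_eqF.
have w1 x : E x -> 0 < w x.
  by move=> /pos xa; rewrite /w sE s'E divr_gt0//; lra.
have := entropy_ge mE DE (fun x Ex => ltW (w1 x Ex)) (fun x Dx => w1 x (DE Dx))
  (has_integral_logpot s1 s'1) hw.
rewrite nu_fin -EFinD => Hge.
(* The tangent inequality at [y0 = J a - x] is integrated against [sigma]; its slope is given by the
   integral of the product of the kernels at [J a] and [J b]. *)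
have tangent : logpot b - logpot a - (theta - J a) * (k * (a * b - 1)^-1) <=
    logpot s' - logpot s.
  apply: (has_integral_le mD _ (has_integralB mD (has_integral_logpot a1 b1)
    (has_integralZ (theta - J a) mD (has_integralZ k mD (has_integral_stieltjesM a1 b1 ab1))))
    (has_integral_logpot s1 s'1)) => x Dx /=.
  have xa := joukowski_sub_gt0 a1 Dx; have xs := joukowski_sub_gt0 s1 Dx.
  have := ln_ratio_tangent xs xa k0.
  have -> : J a - x + k = J b - x by rewrite /k; ring.
  have -> : J s - x + k = J s' - x by rewrite s'E sE; ring.
  by have -> : J s - x - (J a - x) = theta - J a by rewrite sE; ring.
have [hfin|hinf] := boolP (H sigma nu \is a fin_num); last first.
  move: Hge hinf; case: (H sigma nu) => // _ _.
  by rewrite mulry gtr0_sg// mul1e addye// leey.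
move: Hge; rewrite -(fineK hfin) -EFinM -EFinD !lee_fin; set h := fine _ => Hge.
rewrite /Phi -/k.
have kG : k * V theta <= k * ((2 * m + e' - theta) / Gamma).
  by apply: ler_wpM2l => //; rewrite ler_pdivlMr//; lra.
(* Either [J a] is critical and the two sides are equal, or [a = 1], where [theta >= J 1] gives the
   comparison of slopes the right sign. *)
have crit' : (theta - J a) * (k * (a * b - 1)^-1) <= (theta - J a) * (k * Gamma^-1).
  case: crit => [->//|[aE Gab]]; apply: ler_wpM2l; last apply: ler_wpM2l => //.
    by rewrite aE joukowski1; lra.
  by rewrite lef_pV2 ?posrE//; lra.
have ke : k * (e' / Gamma) <= e.
  have -> : k * (e' / Gamma) = e * (k / (k + 1)) by rewrite /e'; field; rewrite !gt_eqF//; lra.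
  by apply: ler_piMr; [lra|rewrite ler_pdivrMr; lra].
have -> : (J a - J b) * (2 * m - J a) / Gamma =
    - (k * ((2 * m + e' - theta) / Gamma)) - (theta - J a) * (k * Gamma^-1) + k * (e' / Gamma).
  by rewrite /k; field; rewrite gt_eqF.
lra.
Qed.

End variational_problem.

Lemma I_G_ge_hi Gamma psi m a t : 0 < Gamma -> 2 <= psi -> 1 <= t -> t <= a ->
  psi <= J t -> psi < J a -> ((Phi Gamma a t m)%:E <= I_G sigma m psi Gamma)%E.
Proof.
move=> G0 psi2 t1 ta psit psia; apply: le_ereal_inf_tmp => _ [nu [nuE mF] <-].
exact: (half_entropy_ge_hi G0 psi2 nuE mF).
Qed.

Lemma I_G_ge_lo Gamma psi m a b : 0 < Gamma -> 2 <= psi -> 1 <= a -> a <= b ->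
  1 < a * b -> a * b - 1 = Gamma \/ a = 1 /\ Gamma <= a * b - 1 ->
  ((Phi Gamma a b m)%:E <= I_G sigma m psi Gamma)%E.
Proof.
move=> G0 psi2 a1 ab ab1 crit; apply: le_ereal_inf_tmp => _ [nu [nuE mF] <-].
exact: (half_entropy_ge_lo G0 psi2 nuE mF).
Qed.

End rate_function_bounds.

(** * Upper bounds from explicit measures *)

Section rate_function_upper_bound.
Context {R : realType}.
Local Notation borel := (measurableTypeR R).
Notation sigma := (semicircle_law R).
Notation D := (`](-2), 2[%classic : set borel).
Notation J := (@joukowski R).

Let mD : measurable D. Proof. exact: measurable_itv. Qed.

Lemma integral_mulr_indic_sub (E : set borel) (f h : R -> R) : D `<=` E ->
  (\int[sigma]_(x in E) ((f x)%:E * (h x * \1_D x)%:E) =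
   \int[sigma]_(x in D) (f x * h x)%:E)%E.
Proof.
move=> DE; rewrite integral_mkcond [RHS]integral_mkcond; apply: eq_integral => x _.
rewrite !patchE indicE; have [xD|xD] := boolP (x \in D).
  by rewrite (mem_set (DE _ (set_mem xD))) mulr1.
by case: ifPn => //; rewrite mulr0 mule0.
Qed.

(* The optimal measure [(J a - x) / (J b - x) sigma + c delta_psi]; [slope] says
   that [J a] minimizes the convex function of [theta] defining [F], possibly at
   the boundary point [psi]. *)
Section construction.
Variables (Gamma psi m a b c : R).
Hypotheses (Gamma0 : 0 < Gamma) (psi2 : 2 <= psi) (a1 : 1 <= a) (b1 : 1 <= b).
Hypotheses (ab1 : 1 < a * b) (c0 : 0 <= c) (psia : psi <= J a).
Hypothesis cpsi : c = 0 \/ psi < J a.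
Hypothesis mE : 2 * m = J a + Gamma / b + Gamma * c / (J a - psi).
Hypothesis slope : Gamma * ((a * b - 1)^-1 + c / (J a - psi) ^+ 2) = 1 \/
  psi = J a /\ Gamma * ((a * b - 1)^-1 + c / (J a - psi) ^+ 2) <= 1.

Let k' x := (J a - x) / (J b - x).
Let k x := k' x * \1_D x.

Let k'_gt0 x : D x -> 0 < k' x.
Proof. by move=> Dx; rewrite divr_gt0 ?joukowski_sub_gt0. Qed.

Let k'E x : D x -> k' x = 1 + (J a - J b) * (J b - x)^-1.
Proof.
move=> Dx; have xb := joukowski_sub_gt0 b1 Dx.
by rewrite /k'; field; rewrite gt_eqF.
Qed.

Let mk' : measurable_fun D k'.
Proof.
by apply: measurable_funM; [exact: measurable_sub_id|exact: measurable_joukowskiV].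
Qed.

Let kE : k = k' \_ D.
Proof.
by apply/funext => x; rewrite patchE /k indicE; case: ifPn; rewrite ?mulr1 ?mulr0.
Qed.

Let mk : measurable_fun setT k.
Proof. by rewrite kE; apply/(measurable_restrictT _ mD). Qed.

Let k_ge0 x : 0 <= k x.
Proof.
rewrite kE patchE; case: ifPn => // /set_mem Dx; exact/ltW/k'_gt0.
Qed.

Let has_integral_k' : has_integral sigma D k' (1 + (J a - J b) / b).
Proof.
apply: (has_integral_eq _ _ _ (has_integralD mD (has_integral_cst 1)
  (has_integralZ (J a - J b) mD (has_integral_stieltjes b1)))) => //.
by move=> x /set_mem Dx /=; rewrite k'E.
Qed.

Let integral_k : (\int[sigma]_x (k x)%:E = (1 + (J a - J b) / b)%:E)%E.
Proof. by rewrite integral_mulr_indic// has_integral_k'.2. Qed.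

Let ki : sigma.-integrable setT (EFin \o k).
Proof.
by have [] := @ge0_has_integral _ _ _ sigma setT k _ measurableT mk (fun x _ => k_ge0 x) integral_k.
Qed.

Let nu : {finite_measure set borel -> \bar R} :=
  @tilted _ borel R sigma k mk k_ge0 (NngNum c0) psi ki.

Let nuE (A : set borel) : nu A = (\int[sigma]_(x in A) (k x)%:E + c%:E * \d_psi A)%E.
Proof. exact: tiltedE. Qed.

Let integral_nu (E : set borel) (f : R -> \bar R) : measurable E -> measurable_fun E f ->
  (forall x, E x -> (0 <= f x)%E) ->
  (\int[nu]_(x in E) f x =
   \int[sigma]_(x in E) (f x * (k x)%:E) + c%:E * (\d_psi E * f psi))%E.
Proof. exact: ge0_integral_tilted. Qed.

Let nu_support : M_plus `[- psi, psi] nu.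
Proof.
have p2 := psi2.
rewrite /M_plus/= nuE diracE memNset ?mule0 ?adde0; last first.
  by move=> h; apply: h; rewrite /= in_itv/= lexx andbT; lra.
apply: integral0_eq => x /= nx; congr EFin.
rewrite kE patchE memNset// /= in_itv/= => /andP[? ?].
by apply: nx; rewrite /= in_itv/=; apply/andP; split; lra.
Qed.



(** The contribution [q] of the absolutely continuous part stays implicit, since only bounds on it
    are used. *)
Let functionalE theta : psi < theta -> exists2 q, has_integral sigma D (fun x => (theta - x)^-1 * k' x) q &
  (\int[nu]_(x in `]-oo, psi]) ((theta - x)^-1)%:E = (q + c / (theta - psi))%:E)%E.
Proof.
have p2 := psi2.
move=> th; have [s s1 sE] := joukowski_surj (ltW (le_lt_trans psi2 th)).
have m1 : measurable (`]-oo, psi]%classic : set borel) by exact: measurable_itv.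
have DE : D `<=` `]-oo, psi].
  move=> x; rewrite /= !in_itv/= => /andP[_ x2].
  by apply/ltW/(lt_le_trans x2).
have mth : measurable_fun (`]-oo, psi]%classic : set borel) (fun x => (theta - x)^-1).
  apply: measurable_funV_gt0 => //; first exact: measurable_sub_id.
  by move=> x; rewrite /= in_itv/=; lra.
have pos x : (`]-oo, psi]%classic : set borel) x -> (0 <= ((theta - x)^-1)%:E)%E.
  by rewrite /= in_itv/= => ?; rewrite lee_fin invr_ge0; lra.
have kint : sigma.-integrable D (EFin \o (fun x => (theta - x)^-1 * k' x)).
  apply: (le_integrable mD _ _ (integrableZl mD (theta - 2)^-1 has_integral_k'.1)).
    apply/measurable_EFinP; apply: measurable_funM => //.
    exact: measurable_funS mth.
  move=> x Dx; have kx := k'_gt0 Dx.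
  have xt : 0 < theta - 2 <= theta - x.
    by move: Dx; rewrite /= in_itv/= => /andP[? ?]; apply/andP; split; lra.
  rewrite -EFinM !abse_EFin lee_fin !normrM ler_wpM2r//.
  case/andP: xt => t2 tx; have tx0 := lt_le_trans t2 tx.
  by rewrite !ger0_norm ?invr_ge0 ?(ltW t2) ?(ltW tx0)// lef_pV2.
exists (fine (\int[sigma]_(x in D) ((theta - x)^-1 * k' x)%:E)%E).
  exact: integrable_has_integral.
rewrite integral_nu//; last exact/measurable_EFinP.
rewrite integral_mulr_indic_sub// EFinD fineK ?integrable_fin_num//.
by rewrite diracE mem_set ?mul1e//= in_itv/= lexx.
Qed.

(** The convex function [theta |-> c / (theta - psi)] is above its tangent at [J a]. If [psi = J a],
    then [c = 0] by [cpsi] and all terms vanish. *)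
Let inv_le_atom theta : psi < theta ->
  c / (J a - psi) - (theta - J a) * (c / (J a - psi) ^+ 2) <= c / (theta - psi).
Proof.
move=> th; case: cpsi => [->|pa]; first by rewrite !mul0r mulr0 subr0.
have y0 : 0 < theta - psi by lra.
have y1 : 0 < J a - psi by lra.
rewrite -subr_ge0.
have -> : c / (theta - psi) - (c / (J a - psi) - (theta - J a) * (c / (J a - psi) ^+ 2)) =
  c * (theta - J a) ^+ 2 / ((theta - psi) * (J a - psi) ^+ 2).
  by field; rewrite !gt_eqF.
apply: divr_ge0; first by rewrite mulr_ge0 ?sqr_ge0// c0.
by rewrite mulr_ge0 ?sqr_ge0// ltW.
Qed.

(** Replacing each convex term by its tangent at [J a] bounds the functional below by an affine
    function of [theta] that equals [2 * m] at [J a]. By [slope] this function is constant, or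
    nondecreasing with [theta > psi = J a]. *)
Let functional_ge theta q : psi < theta ->
  has_integral sigma D (fun x => (theta - x)^-1 * k' x) q ->
  2 * m <= theta + Gamma * (q + c / (theta - psi)).
Proof.
have G0 := Gamma0; have p2 := psi2; have psia' := psia.
move=> th hq.
have qge : b^-1 - (theta - J a) * (a * b - 1)^-1 <= q.
  apply: (has_integral_le mD _ (has_integralB mD (has_integral_stieltjes b1)
    (has_integralZ (theta - J a) mD (has_integral_stieltjesM a1 b1 ab1))) hq) => x Dx /=.
  have xa := joukowski_sub_gt0 a1 Dx; have xb := joukowski_sub_gt0 b1 Dx.
  have xt : 0 < theta - x by move: Dx; rewrite /= in_itv/= => /andP[? ?]; lra.
  rewrite /k' -subr_ge0.
  have -> : (theta - x)^-1 * ((J a - x) / (J b - x)) -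
     ((J b - x)^-1 - (theta - J a) * ((J a - x)^-1 * (J b - x)^-1)) =
     (theta - J a) ^+ 2 / ((theta - x) * (J a - x) * (J b - x)).
    by field; rewrite !gt_eqF.
  apply: divr_ge0; first exact: sqr_ge0.
  by rewrite ltW// !mulr_gt0.
have atom := inv_le_atom th.
have := slope; set S := (a * b - 1)^-1 + c / (J a - psi) ^+ 2 => slopeS.
have : Gamma * (b^-1 + c / (J a - psi) - (theta - J a) * S) <= Gamma * (q + c / (theta - psi)).
  by rewrite ler_pM2l// /S; lra.
have : 0 <= (theta - J a) * (1 - Gamma * S).
  by case: slopeS => [->|[pE S1]]; [rewrite subrr mulr0|rewrite mulr_ge0//; lra].
have := mE; rewrite -[Gamma * c / _]mulrA; lra.
Qed.

(** The evaluation is at [J a + e] because [psi = J a] is allowed whereas the infimum runs over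
    [theta > psi]. Both kernels decrease in [theta], so at most [e] is lost. *)
Let functional_le (e : R) q : 0 < e ->
  has_integral sigma D (fun x => (J a + e - x)^-1 * k' x) q ->
  J a + e + Gamma * (q + c / (J a + e - psi)) <= 2 * m + e.
Proof.
have G0 := Gamma0; have p2 := psi2; have psia' := psia.
move=> e0 hq.
have qle : q <= b^-1.
  apply: (has_integral_le mD _ hq (has_integral_stieltjes b1)) => x Dx /=.
  have xa := joukowski_sub_gt0 a1 Dx; have xb := joukowski_sub_gt0 b1 Dx.
  rewrite /k' mulrA; apply: ler_piMl; first by rewrite invr_ge0 ltW.
  by rewrite mulrC ler_pdivrMr; lra.
have atom : c / (J a + e - psi) <= c / (J a - psi).
  case: cpsi => [->|pa]; first by rewrite !mul0r.
  by rewrite ler_wpM2l ?c0// lef_pV2 ?posrE; lra.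
have : Gamma * (q + c / (J a + e - psi)) <= Gamma * (b^-1 + c / (J a - psi)).
  by rewrite ler_pM2l//; lra.
have := mE; rewrite -[Gamma * c / _]mulrA; lra.
Qed.

Let FE : m%:E = F psi nu Gamma.
Proof.
have G0 := Gamma0; have p2 := psi2; have psia' := psia.
rewrite /F; set S := [set _ | _ in _].
suff -> : ereal_inf S = (2 * m)%:E by rewrite -EFinM mulKf.
apply/eqP; rewrite eq_le; apply/andP; split; last first.
  apply: le_ereal_inf_tmp => _ [theta th <-].
  have [q hq ->] := functionalE th.
  by rewrite -EFinM -EFinD lee_fin functional_ge.
apply/lee_addgt0Pr => e e0; apply: ge_ereal_inf.
have th : psi < J a + e by lra.
exists ((J a + e)%:E + Gamma%:E * \int[nu]_(x in `]-oo, psi]) ((J a + e - x)^-1)%:E)%E.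
  by exists (J a + e).
have [q hq ->] := functionalE th.
by rewrite -EFinM -!EFinD lee_fin functional_le.
Qed.

Lemma I_G_le_tilted : (I_G sigma m psi Gamma <=
  (2^-1 * ((J a - J b) / b + c + logpot b - logpot a))%:E)%E.
Proof.
apply: ge_ereal_inf; exists (2^-1%:E * H sigma nu)%E.
  by exists nu; first by split; [exact: nu_support|exact: FE].
rewrite EFinM lee_pmul2l ?lte_fin//.
have hL : has_integral sigma D (fun x => ln (k x)) (logpot a - logpot b).
  apply: (has_integral_eq _ _ _ (has_integral_logpot b1 a1)) => // x xD /=.
  by rewrite kE patchE xD.
have kD x : D x -> 0 < k x by move=> Dx; rewrite kE patchE mem_set// k'_gt0.
apply: le_trans (entropy_le mk k_ge0 kD hL _) _.
  move=> E f mE' mf f0; rewrite integral_nu// leeDl// diracE.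
  have [/set_mem psiE|_] := boolP (psi \in E); last by rewrite mul0e mule0.
  by rewrite mul1e mule_ge0 ?lee_fin// f0.
rewrite nuE integral_k diracE mem_set// mule1 -!EFinD lee_fin.
lra.
Qed.

End construction.
End rate_function_upper_bound.

(** * The explicit annealed rate *)

Section critical_means.
Context {R : realType}.
Variable Gamma : R.
Hypothesis Gamma0 : 0 < Gamma.
Notation J := (@joukowski R).
Implicit Types m a b t : R.

Let c2 := (1 + 2 * Gamma) / (1 + Gamma).

Let c2_gt1 : 1 < c2.
Proof. by have G0 := Gamma0; rewrite /c2 ltr_pdivlMr; lra. Qed.

Let m_c2 : m_c Gamma ^+ 2 = c2.
Proof. by rewrite sqr_sqrtr// ltW// (lt_trans _ c2_gt1). Qed.

(* With [b = (1 + Gamma) / a], the mean [m] solving [2 m = a + 1 / a + Gamma / b]. *)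
Definition free_mean a : R := 2^-1 * (c2 * a + a^-1).

Lemma free_meanE a : 0 < a -> 2 * free_mean a = J a + Gamma / ((1 + Gamma) / a).
Proof.
by have G0 := Gamma0; move=> a0; rewrite /free_mean /joukowski /c2; field; rewrite !gt_eqF//; lra.
Qed.

Lemma is_derive_free_mean a : 0 < a ->
  is_derive a 1 free_mean (2^-1 * (c2 - a ^- 2)).
Proof.
move=> a0; have a0' : a != 0 by rewrite gt_eqF.
have d : is_derive a 1 (fun y : R => y^-1) (- a ^- 2 * 1).
  by apply: (@is_derive_inv R id).
have := is_deriveZ 2^-1 (is_deriveD (is_deriveZ c2 (is_derive_id a 1)) d).
by move/is_derive_eq; apply; rewrite /GRing.scale/=; ring.
Qed.

Let derive_gt0 a : 1 <= a -> 0 < 2^-1 * (c2 - a ^- 2).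
Proof.
move=> a1; have c2_1 := c2_gt1; have : a ^- 2 <= 1 by rewrite invf_le1; nra.
lra.
Qed.

Lemma free_mean_lt a b : 1 <= a -> a < b -> free_mean a < free_mean b.
Proof.
move=> a1 ab; apply: (@is_derive_mono_lt _ a b free_mean (fun x => 2^-1 * (c2 - x ^- 2)) ab) => x /andP[ax xb].
  by apply: is_derive_free_mean; lra.
by apply: derive_gt0; lra.
Qed.

Lemma free_mean_le a b : 1 <= a -> 1 <= b -> (free_mean a <= free_mean b) = (a <= b).
Proof.
move=> a1 b1; have [ab|ba|->] := ltgtP a b; last by rewrite lexx.
  by rewrite ltW// free_mean_lt.
by apply/negbTE; rewrite -ltNge free_mean_lt.
Qed.

Lemma free_mean1 : free_mean 1 = m_L Gamma.
Proof.
by have G0 := Gamma0; rewrite /free_mean /m_L /c2; field; rewrite gt_eqF//; lra.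
Qed.

Lemma free_mean_U : free_mean (1 + Gamma) = m_U Gamma.
Proof.
by have G0 := Gamma0; rewrite /free_mean /m_U /c2; field; rewrite gt_eqF//; lra.
Qed.

Lemma free_mean_bar : free_mean (Num.sqrt (1 + Gamma)) = m_bar Gamma.
Proof.
have G0 := Gamma0; rewrite /free_mean /m_bar /c2.
have s0 : 0 < Num.sqrt (1 + Gamma) by rewrite sqrtr_gt0; lra.
have : Num.sqrt (1 + Gamma) ^+ 2 = 1 + Gamma by rewrite sqr_sqrtr//; lra.
move: (Num.sqrt (1 + Gamma)) s0 => s s0 sE.
have -> : Gamma = s ^+ 2 - 1 by lra.
by field; rewrite !gt_eqF//; nra.
Qed.

Lemma free_mean_surj m : m_L Gamma <= m -> exists2 a, 1 <= a & free_mean a = m.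
Proof.
have c2_1 := c2_gt1.
rewrite -free_mean1 /free_mean invr1 mulr1 => mL.
pose s := Num.sqrt (m ^+ 2 - c2).
have s0 : 0 <= s by exact: sqrtr_ge0.
have ss : s ^+ 2 = m ^+ 2 - c2 by rewrite sqr_sqrtr//; nra.
have sL : 2^-1 * (c2 - 1) <= s by nra.
(* The larger root of [c2 * a ^+ 2 - 2 * m * a + 1], which is at least [1] because [m_L] is the mean
   at [a = 1]. *)
exists ((m + s) / c2); first by rewrite ler_pdivlMr; lra.
have ms : 0 < m + s by lra.
have -> : ((m + s) / c2)^-1 = m - s.
  have ms0 : m + s != 0 by rewrite gt_eqF.
  by rewrite invf_div; apply: (mulIf ms0); rewrite divfK//; lra.
have c20 : c2 != 0 by rewrite gt_eqF//; lra.
by rewrite (mulrC c2) divfK//; field.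
Qed.

(** In the parameter [a] the discriminant is the square of [2^-1 * (c2 * a - a^-1)], so the radicals
    disappear. *)
Lemma free_params a : 1 <= a ->
  alpha_a Gamma (free_mean a) = a /\ beta_aV Gamma (free_mean a) = (1 + Gamma) / a.
Proof.
move=> a1; have c2_1 := c2_gt1; have a0 : a != 0 by rewrite gt_eqF//; lra.
have sE : Num.sqrt (free_mean a ^+ 2 - m_c Gamma ^+ 2) = 2^-1 * (c2 * a - a^-1).
  rewrite m_c2 /free_mean.
  have -> : (2^-1 * (c2 * a + a^-1)) ^+ 2 - c2 = (2^-1 * (c2 * a - a^-1)) ^+ 2 by field.
  rewrite sqrtr_sqr ger0_norm// mulr_ge0// subr_ge0.
  by apply: (@le_trans _ _ 1); [rewrite invf_le1; lra|nra].
rewrite /alpha_a /beta_aV sE m_c2 /free_mean; split; last by field.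
by field; rewrite gt_eqF//; lra.
Qed.

Lemma critical_means :
  [/\ 1 < m_c Gamma, m_c Gamma < m_L Gamma, m_L Gamma < m_bar Gamma
    & m_bar Gamma < m_U Gamma].
Proof.
have G0 := Gamma0; have c2_1 := c2_gt1.
have c0 : 0 <= m_c Gamma by exact: sqrtr_ge0.
have s1 : 1 < Num.sqrt (1 + Gamma).
  by rewrite -[X in X < _]sqrtr1 ltr_sqrt; lra.
have s2 : Num.sqrt (1 + Gamma) ^+ 2 = 1 + Gamma by rewrite sqr_sqrtr//; lra.
split.
- by have := m_c2; nra.
- rewrite -free_mean1 /free_mean invr1 mulr1.
  by have := m_c2; nra.
- by rewrite -free_mean1 -free_mean_bar free_mean_lt.
- by rewrite -free_mean_bar -free_mean_U free_mean_lt; nra.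
Qed.

(** The relation between [m], [a] and [b] is the constraint for the measure without atom; under it
    the dual bound becomes the candidate value. *)
Lemma Phi_calI a b m : 0 < a -> 0 < b -> 2 * m = J a + Gamma / b ->
  Phi Gamma a b m = calI a b.
Proof.
move=> a0 b0 E; have G0 := Gamma0.
rewrite /Phi /calI /J_1 /logpot ln_div ?posrE//.
have -> : 2 * m - J a = Gamma / b by lra.
by rewrite /joukowski; field; rewrite !gt_eqF.
Qed.

(** This is why the formula of the regime without atom persists in the annealed case beyond [m_U],
    with [b = t^-1] below [1]. *)
Lemma Phi_edge_cost a t m : 0 < a -> 0 < t -> 2 * m = J a + Gamma * t ->
  Phi Gamma a t m + edge_cost t = calI a t^-1.
Proof.
move=> a0 t0 E; have G0 := Gamma0.
rewrite /Phi /calI /J_1 /logpot /edge_cost invrK lnM ?posrE//.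
have -> : 2 * m - J a = Gamma * t by lra.
by rewrite /joukowski; field; rewrite !gt_eqF.
Qed.

Lemma Phi_diag a m : Phi Gamma a a m = 0.
Proof. by rewrite /Phi !subrr !mul0r addr0 mulr0. Qed.

(* [t] is the free parameter of the lower bounds for [psi = J t]; the infimum
   over [t >= 1] is reached at [max 1 v], where [v] is the inverse of [b]. *)
Lemma is_derive_Phi_edge_cost a m v t : 0 < t -> 2 * m = J a + Gamma * v ->
  is_derive t 1 (fun t => Phi Gamma a t m + edge_cost t)
    (2^-1 * (1 - t ^- 2) * (t - v)).
Proof.
move=> t0 E; have G0 := Gamma0; have t0' : t != 0 by rewrite gt_eqF.
have dL := is_derive_logpot t0; have dJ := is_derive_joukowski t0.
have dE := is_derive_edge_cost t0.
have d1 : is_derive t 1 (fun t => (J a - J t) * v) ((0 - (1 - t ^- 2)) * v).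
  have := is_deriveM (is_deriveB (is_derive_cst (J a) t 1) dJ) (is_derive_cst v t 1).
  by move/is_derive_eq; apply; rewrite /GRing.scale/=; ring.
have := is_deriveD (is_deriveZ 2^-1 (is_deriveD (is_deriveB dL (is_derive_cst (logpot a) t 1)) d1)) dE.
have -> : (fun t => Phi Gamma a t m + edge_cost t) =
   (fun t => 2^-1 * (logpot t - logpot a + (J a - J t) * v) + edge_cost t).
  apply/funext => x; rewrite /Phi; congr (_ * (_ + _) + _).
  have -> : 2 * m - J a = Gamma * v by lra.
  by field; rewrite gt_eqF.
by move/is_derive_eq; apply; rewrite /GRing.scale/=; field.
Qed.

Lemma Phi_edge_cost_incr a m v s t : 1 <= s -> s <= t -> v <= s ->
  2 * m = J a + Gamma * v ->
  Phi Gamma a s m + edge_cost s <= Phi Gamma a t m + edge_cost t.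
Proof.
move=> s1 st vs E; apply: (@is_derive_mono_le _ s t (fun t => Phi Gamma a t m + edge_cost t)
  (fun x => 2^-1 * (1 - x ^- 2) * (x - v)) st) => x /andP[sx xt].
  by apply: is_derive_Phi_edge_cost => //; lra.
have : x ^- 2 <= 1 by rewrite invf_le1; nra.
by move=> x2; rewrite !mulr_ge0//; lra.
Qed.

Lemma Phi_edge_cost_decr a m v s t : 1 <= s -> s <= t -> t <= v ->
  2 * m = J a + Gamma * v ->
  Phi Gamma a t m + edge_cost t <= Phi Gamma a s m + edge_cost s.
Proof.
move=> s1 st tv E; rewrite -lerN2.
apply: (@is_derive_mono_le _ s t (fun t => - (Phi Gamma a t m + edge_cost t))
  (fun x => - (2^-1 * (1 - x ^- 2) * (x - v))) st) => x /andP[sx xt].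
  have x0 : 0 < x by lra.
  exact: is_deriveN (is_derive_Phi_edge_cost x0 E).
have : x ^- 2 <= 1 by rewrite invf_le1; nra.
by move=> x2; rewrite -mulrN mulr_ge0//; lra.
Qed.

Lemma edge_cost_le (s t : R) : 1 <= s -> s <= t -> edge_cost s <= edge_cost t.
Proof.
move=> s1 st; apply: (@is_derive_mono_le _ s t edge_cost
  (fun x => 2^-1 * (x - x^-1) * (1 - x ^- 2)) st) => x /andP[sx xt].
  by apply: is_derive_edge_cost; lra.
have x2 : x ^- 2 <= 1 by rewrite invf_le1; nra.
have x1 : x^-1 <= x by apply: (@le_trans _ _ 1); [rewrite invf_le1; lra|lra].
by rewrite !mulr_ge0//; lra.
Qed.

Lemma edge_cost_ge0 (t : R) : 1 <= t -> 0 <= edge_cost t.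
Proof. by move=> t1; rewrite -edge_cost1 edge_cost_le. Qed.

Definition annealed_rate m : R :=
  if m <= m_L Gamma then calI 1 (Gamma / (2 * (m - 1)))
  else calI (alpha_a Gamma m) (beta_aV Gamma m).

(** The derivative of [annealed_rate]. Both branches give [- Gamma / (1 + Gamma)] at [m_L]. *)
Definition annealed_slope m : R :=
  if m <= m_L Gamma then
    - (1 - 2 * (m - 1) / Gamma) ^+ 2 / (2 * (m - 1))
  else alpha_a Gamma m / (1 + Gamma) - (alpha_a Gamma m)^-1.

(** A chord inequality in parametric form: [s] is the slope of [f] with respect to [g], and as [s]
    increases, so do [f - s x * g] and [s y * g - f]. *)
Let slope_mono (x y : R) (f g s g' : R -> R) : x < y ->
  (forall z, x <= z <= y -> is_derive z 1 f (s z * g' z)) ->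
  (forall z, x <= z <= y -> is_derive z 1 g (g' z)) ->
  (forall z, x <= z <= y -> 0 < g' z) ->
  (forall z t, x <= z -> z < t -> t <= y -> s z < s t) ->
  s x * (g y - g x) < f y - f x < s y * (g y - g x).
Proof.
move=> xy df dg g0 sI.
have dh k z : x <= z <= y -> is_derive z 1 (fun z => f z - k * g z) ((s z - k) * g' z).
  move=> xzy; apply: is_derive_eq (is_deriveB (df z xzy) (is_deriveZ k (dg z xzy))) _.
  by rewrite /GRing.scale/=; ring.
have dh' k z : x <= z <= y -> is_derive z 1 (fun z => k * g z - f z) ((k - s z) * g' z).
  move=> xzy; apply: is_derive_eq (is_deriveB (is_deriveZ k (dg z xzy)) (df z xzy)) _.
  by rewrite /GRing.scale/=; ring.
have H1 := is_derive_mono_lt xy (dh (s x)).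
have H2 := is_derive_mono_lt xy (dh' (s y)).
apply/andP; split.
  have : f x - s x * g x < f y - s x * g y.
    apply: H1 => z /andP[xz zy]; apply: mulr_gt0; last by apply: g0; rewrite !ltW.
    by rewrite subr_gt0; apply: sI => //; exact: ltW.
  lra.
have : s y * g x - f x < s y * g y - f y.
  apply: H2 => z /andP[xz zy]; apply: mulr_gt0; last by apply: g0; rewrite !ltW.
  by rewrite subr_gt0; apply: sI => //; exact: ltW.
lra.
Qed.

Let slope_low x y : 1 < x -> x < y -> y <= m_L Gamma ->
  annealed_slope x * (y - x) < annealed_rate y - annealed_rate x < annealed_slope y * (y - x).
Proof.
have G0 := Gamma0; move=> x1 xy yL.
have xL : x <= m_L Gamma by lra.
(* The inverse of the second argument of [calI] serves as parameter; the mean is affine in it. *)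
pose b m := 2 * (m - 1) / Gamma.
have b0 m : 1 < m -> 0 < b m by move=> m1; rewrite divr_gt0//; lra.
have bL m : m <= m_L Gamma -> b m < 1.
  move=> mL; rewrite /b ltr_pdivrMr// mul1r; move: mL; rewrite /m_L => mL.
  have : Gamma / (2 * (1 + Gamma)) < Gamma / 2 by rewrite ltr_pM2l// ltf_pV2 ?posrE; nra.
  lra.
pose f t := 2^-1 * (t - 1 - ln t) - 4^-1 * (1 - t) ^+ 2.
have fE m : 1 < m -> m <= m_L Gamma -> annealed_rate m = f (b m).
  move=> m1 mL; rewrite /annealed_rate mL /calI /J_1 /f.
  have -> : Gamma / (2 * (m - 1)) = (b m)^-1 by rewrite invf_div.
  by rewrite invrK mul1r invr1.
have sE m : 1 < m -> m <= m_L Gamma ->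
    annealed_slope m = 2 / Gamma * (- (1 - b m) ^+ 2 / (2 * b m)).
  move=> m1 mL; rewrite /annealed_slope mL /b.
  by field; rewrite !gt_eqF//; lra.
have y1 : 1 < y by lra.
rewrite !fE ?sE//.
have bxy : b x < b y by rewrite /b ltr_pM2r ?invr_gt0//; lra.
have yx : y - x = (1 + Gamma / 2 * b y) - (1 + Gamma / 2 * b x).
  by rewrite /b; field; rewrite gt_eqF.
rewrite yx.
have bx0 := b0 _ x1; have by1 := bL _ yL.
pose s t := 2 / Gamma * (- (1 - t) ^+ 2 / (2 * t)).
have df z : b x <= z <= b y -> is_derive z 1 f (s z * (Gamma / 2)).
  move=> /andP[xz zy]; have z0 : 0 < z by lra.
  have d2 : is_derive z 1 (fun t : R => (1 - t) ^+ 2) (- (2 * (1 - z))).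
    by apply: is_derive_eq; rewrite /GRing.scale/=; ring.
  have := is_deriveB (is_deriveZ 2^-1 (is_deriveB (is_deriveB (is_derive_id z 1)
    (is_derive_cst (1 : R) z 1)) (is_derive1_ln z0))) (is_deriveZ 4^-1 d2).
  by move/is_derive_eq; apply; rewrite /s /GRing.scale/=; field; rewrite !gt_eqF.
have dg z : b x <= z <= b y -> is_derive z 1 (fun t => 1 + Gamma / 2 * t) (Gamma / 2).
  move=> _; have := is_deriveD (is_derive_cst (1 : R) z 1) (is_deriveZ (Gamma / 2) (is_derive_id z 1)).
  by move/is_derive_eq; apply; rewrite /GRing.scale/=; ring.
have g0 z : b x <= z <= b y -> 0 < Gamma / 2 by move=> _; lra.
(* The slope increases only because [t * z < 1], which comes from [y <= m_L]. *)
have sI z t : b x <= z -> z < t -> t <= b y -> s z < s t.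
  move=> xz zt ty; have z0 : 0 < z by lra.
  have t0 : 0 < t by lra.
  have G2 : 0 < 2 / Gamma by rewrite divr_gt0.
  rewrite /s ltr_pM2l// -subr_gt0.
  have -> : - (1 - t) ^+ 2 / (2 * t) - - (1 - z) ^+ 2 / (2 * z) =
     (t - z) * (1 - t * z) / (2 * (t * z)) by field; rewrite !gt_eqF.
  apply: divr_gt0; last by rewrite !mulr_gt0.
  by apply: mulr_gt0; nra.
exact (slope_mono bxy df dg g0 sI).
Qed.

(** At [a = 1] the definitions take their first branch, which has to be matched with the second;
    this glues the two regimes at [m_L]. *)
Let rate_high a : 1 <= a ->
  annealed_rate (free_mean a) = calI a ((1 + Gamma) / a) /\
  annealed_slope (free_mean a) = a / (1 + Gamma) - a^-1.
Proof.
have G0 := Gamma0; move=> a1; have [aE bE] := free_params a1.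
rewrite /annealed_rate /annealed_slope -free_mean1 free_mean_le//.
rewrite aE bE; case: ifPn => [a1'|//].
have -> : a = 1 by apply/eqP; rewrite eq_le a1 a1'.
have -> : 2 * (free_mean 1 - 1) = Gamma / (1 + Gamma).
  by rewrite /free_mean /c2; field; rewrite gt_eqF//; lra.
by split; [congr calI|]; field; rewrite !gt_eqF//; lra.
Qed.

Let slope_high x y : m_L Gamma <= x -> x < y ->
  annealed_slope x * (y - x) < annealed_rate y - annealed_rate x < annealed_slope y * (y - x).
Proof.
have G0 := Gamma0; move=> Lx xy; have Ly : m_L Gamma <= y by lra.
have [a a1 aE] := free_mean_surj Lx; have [b b1 bE] := free_mean_surj Ly.
have ab : a < b by rewrite -aE -bE ltNge free_mean_le// -ltNge in xy.
have [rx sx] := rate_high a1; have [ry sy] := rate_high b1.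
rewrite -aE -bE rx sx ry sy.
(* In terms of [q] one has [c2 = 2 - q], and [calI] along the curve becomes the explicit function
   [f] below, which is differentiated term by term. *)
pose q := (1 + Gamma)^-1.
have q0 : 0 < q by rewrite invr_gt0; lra.
have q1 : 1 + Gamma = q^-1 by rewrite invrK.
have GE : Gamma = q^-1 - 1 by rewrite -q1; ring.
have c2E : c2 = 2 - q by rewrite /c2 /q; field; rewrite gt_eqF//; lra.
pose f t := 2^-1 * (q * t ^+ 2 - 1 - (ln q + 2 * ln t)) - 4^-1 * (t ^- 2 - 2 * q + q ^+ 2 * t ^+ 2).
have fE t : 1 <= t -> calI t ((1 + Gamma) / t) = f t.
  move=> t1; rewrite /calI /J_1 /f q1.
  have t0 : 0 < t by lra.
  have -> : t / (q^-1 / t) = q * t * t by field; rewrite !gt_eqF.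
  rewrite !lnM ?posrE ?mulr_gt0//.
  by field; rewrite !gt_eqF.
rewrite !fE//.
pose s t := t / (1 + Gamma) - t^-1.
have df z : a <= z <= b -> is_derive z 1 f (s z * (2^-1 * (c2 - z ^- 2))).
  move=> /andP[az zb]; have z0 : 0 < z by lra.
  have z0' : z != 0 by rewrite gt_eqF.
  have d2 : is_derive z 1 (fun t : R => t ^+ 2) (2 * z).
    by apply: is_derive_eq; rewrite /GRing.scale/=; ring.
  have d3 : is_derive z 1 (fun y : R => (y ^+ 2)^-1) (- (z ^+ 2) ^- 2 * (2 * z)).
    by apply: is_derive_inv; rewrite expf_neq0.
  have := is_deriveB (is_deriveZ 2^-1 (is_deriveB (is_deriveB (is_deriveZ q d2)
    (is_derive_cst (1 : R) z 1)) (is_deriveD (is_derive_cst (ln q) z 1) (is_deriveZ 2 (is_derive1_ln z0)))))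
    (is_deriveZ 4^-1 (is_deriveD (is_deriveB d3 (is_derive_cst (2 * q) z 1)) (is_deriveZ (q ^+ 2) d2))).
  move/is_derive_eq; apply; rewrite /s /GRing.scale/= c2E q1.
  by field; rewrite !gt_eqF.
have dg z : a <= z <= b -> is_derive z 1 free_mean (2^-1 * (c2 - z ^- 2)).
  by move=> /andP[az zb]; apply: is_derive_free_mean; lra.
have g0 z : a <= z <= b -> 0 < 2^-1 * (c2 - z ^- 2).
  by move=> /andP[az zb]; apply: derive_gt0; lra.
have sI z t : a <= z -> z < t -> t <= b -> s z < s t.
  move=> az zt tb; have : t^-1 < z^-1 by rewrite ltf_pV2 ?posrE; lra.
  have : z / (1 + Gamma) < t / (1 + Gamma) by rewrite ltr_pM2r.
  by rewrite /s; lra.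
exact (slope_mono ab df dg g0 sI).
Qed.

(** A chord that crosses [m_L] is cut there, and the slopes of the two pieces are chained through
    [annealed_slope (m_L Gamma)]. *)
Lemma annealed_rate_slope x y : 1 < x -> x < y ->
  annealed_slope x * (y - x) < annealed_rate y - annealed_rate x < annealed_slope y * (y - x).
Proof.
move=> x1 xy; have [yL|Ly] := leP y (m_L Gamma); first exact: slope_low.
have [Lx|xL] := leP (m_L Gamma) x; first exact: slope_high.
have /andP[A1 A2] := slope_low x1 xL (lexx _).
have /andP[B1 B2] := slope_high (lexx _) Ly.
have s1 : annealed_slope x < annealed_slope (m_L Gamma).
  by have := lt_trans A1 A2; rewrite ltr_pM2r// subr_gt0.
have s2 : annealed_slope (m_L Gamma) < annealed_slope y.
  by have := lt_trans B1 B2; rewrite ltr_pM2r// subr_gt0.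
have : annealed_slope x * (y - m_L Gamma) < annealed_slope (m_L Gamma) * (y - m_L Gamma).
  by rewrite ltr_pM2r// subr_gt0.
have : annealed_slope (m_L Gamma) * (m_L Gamma - x) < annealed_slope y * (m_L Gamma - x).
  by rewrite ltr_pM2r// subr_gt0.
move=> C1 C2; apply/andP; split; lra.
Qed.

Lemma annealed_rate_support x y : 1 < x -> 1 < y ->
  annealed_rate x + annealed_slope x * (y - x) <= annealed_rate y.
Proof.
move=> x1 y1; have [xy|yx|->] := ltgtP x y.
- by have /andP[] := annealed_rate_slope x1 xy; lra.
- by have /andP[] := annealed_rate_slope y1 yx; lra.
- by rewrite subrr mulr0 addr0.
Qed.

Lemma annealed_rate_convex x y t : 1 < x -> 1 < y -> x != y -> 0 < t < 1 ->
  annealed_rate (t * x + (1 - t) * y) < t * annealed_rate x + (1 - t) * annealed_rate y.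
Proof.
wlog xy : x y t / x < y => [H x1 y1 xy t01|].
  have [xy'|yx|E] := ltgtP x y; first exact: H.
    have t01' : 0 < 1 - t < 1 by case/andP: t01 => ? ?; apply/andP; split; lra.
    rewrite eq_sym in xy; have := H y x (1 - t) yx y1 x1 xy t01'.
    have -> : (1 - t) * y + (1 - (1 - t)) * x = t * x + (1 - t) * y by ring.
    lra.
  by rewrite E eqxx in xy.
move=> x1 y1 _ /andP[t0 t1]; set z := t * x + (1 - t) * y.
have xz : x < z by rewrite /z; nra.
have zy : z < y by rewrite /z; nra.
have z1 : 1 < z by lra.
have /andP[_ A] := annealed_rate_slope x1 xz.
have /andP[B _] := annealed_rate_slope z1 zy.
have zx : z - x = (1 - t) * (y - x) by rewrite /z; ring.
have yz : y - z = t * (y - x) by rewrite /z; ring.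
rewrite zx in A; rewrite yz in B.
have t1' : 0 < 1 - t by lra.
have A' : t * (annealed_rate z - annealed_rate x) < t * (annealed_slope z * ((1 - t) * (y - x))).
  by rewrite ltr_pM2l.
have B' : (1 - t) * (annealed_slope z * (t * (y - x))) < (1 - t) * (annealed_rate y - annealed_rate z).
  by rewrite ltr_pM2l.
have E : t * (annealed_slope z * ((1 - t) * (y - x))) = (1 - t) * (annealed_slope z * (t * (y - x))) by ring.
lra.
Qed.

(** Near [m = 1] the rate blows up like [- ln b / 2] with [b = 2 * (m - 1) / Gamma]. For
    [0 < b <= 1] its other terms are at least [- 3 / 4], whence the constant [3 / 2]. *)
Lemma annealed_rate_low_bound m c : 1 < m -> annealed_rate m <= c ->
  Num.min (m_L Gamma) (1 + Gamma / 2 * expR (- (2 * c + 3 / 2))) <= m.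
Proof.
have G0 := Gamma0; move=> m1 mc; have [mL|Lm] := leP m (m_L Gamma); last first.
  by rewrite (le_trans _ (ltW Lm))// ge_min lexx.
rewrite ge_min; apply/orP; right.
move: mc; rewrite /annealed_rate mL /calI /J_1.
set b := 2 * (m - 1) / Gamma.
have b0 : 0 < b by rewrite divr_gt0//; lra.
have -> : Gamma / (2 * (m - 1)) = b^-1 by rewrite invf_div.
have b1 : b <= 1.
  rewrite ler_pdivrMr// mul1r; move: mL; rewrite /m_L.
  have : Gamma / (2 * (1 + Gamma)) <= Gamma / 2 by rewrite ler_pM2l// lef_pV2 ?posrE; nra.
  lra.
rewrite invrK mul1r invr1 => mc.
have : - (2 * c + 3 / 2) <= ln b by nra.
rewrite -ler_expR lnK ?posrE// => eb.
have : Gamma / 2 * expR (- (2 * c + 3 / 2)) <= Gamma / 2 * b by rewrite ler_pM2l//; lra.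
have -> : Gamma / 2 * b = m - 1 by rewrite /b; field; rewrite gt_eqF.
lra.
Qed.

(** The supporting line at [m_U] therefore grows, which bounds sublevel sets from above. *)
Lemma annealed_slope_U : 0 < annealed_slope (m_U Gamma).
Proof.
have G0 := Gamma0; have G1 : 1 <= 1 + Gamma by lra.
rewrite -free_mean_U (rate_high G1).2 divff; last by rewrite gt_eqF//; lra.
by rewrite subr_gt0 invf_lt1; lra.
Qed.

Lemma annealed_rate_free a : 1 <= a ->
  annealed_rate (free_mean a) = calI a ((1 + Gamma) / a).
Proof. by move=> /rate_high[]. Qed.

End critical_means.

(** * Identification of the rate functions *)

Section rate_functions_values.
Context {R : realType}.
Variable Gamma : R.
Hypothesis Gamma0 : 0 < Gamma.
Notation J := (@joukowski R).
Notation sigma := (semicircle_law R).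
Implicit Types m psi a b t : R.

(** The dual bound with [t = a], that is with the constant test function [1], is [0]. *)
Lemma I_G_ge0 m psi : 2 <= psi -> (0 <= I_G sigma m psi Gamma)%E.
Proof.
move=> psi2; have [p p1 pE] := joukowski_surj psi2.
have p11 : p <= p + 1 by lra.
have p12 : p < p + 1 by lra.
have q1 : 1 <= p + 1 by lra.
rewrite -[0%E]/(0%:E) -(Phi_diag Gamma (p + 1) m).
by apply: I_G_ge_hi => //; rewrite -pE; [exact: joukowski_le|exact: joukowski_lt].
Qed.

Lemma I_e_ge0 psi : (0 <= I_e psi)%E.
Proof. by apply: integral_ge0 => x _; rewrite lee_fin sqrtr_ge0. Qed.

(** For [m <= 1] the dual bound at [a = 1] is unbounded in [b]: its linear term is nonnegative, and
    [logpot b] grows like [ln b]. *)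
Lemma I_G_le1 m psi : 2 <= psi -> m <= 1 -> I_G sigma m psi Gamma = +oo%E.
Proof.
move=> psi2 m1; have G0 := Gamma0; apply/eqyP => A A0.
(* The first factor gives [Gamma <= a * b - 1] at [a = 1]; in the exponent, [2^-1] compensates
   [logpot 1]. *)
pose b := (1 + Gamma) * expR (2 * A + 2^-1).
have e1 : 1 <= expR (2 * A + 2^-1) by apply: le_trans (expR_ge1Dx _); lra.
have bG : 1 + Gamma <= b by rewrite /b; nra.
have b1 : 1 <= b by lra.
apply: (@le_trans _ _ (Phi Gamma 1 b m)%:E); last first.
  apply: I_G_ge_lo => //; rewrite ?mul1r; first by lra.
  by right; split => //; lra.
rewrite lee_fin /Phi joukowski1 /logpot ln1 expr1n invr1.
have lb : 2 * A + 2^-1 <= ln b.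
  rewrite /b lnM ?posrE ?expR_gt0//; last by lra.
  by rewrite expRK lerDr ln_ge0//; lra.
have b2 : 0 <= 2^-1 * b ^- 2 by rewrite mulr_ge0// invr_ge0 sqr_ge0.
have : 0 <= (2 - J b) * (2 * m - 2) / Gamma.
  apply: divr_ge0; last exact: ltW.
  by have := joukowski_ge2 b1; nra.
lra.
Qed.

Let m_order := critical_means Gamma0.

(** At [a = 1] this is the condition [Gamma <= a * b - 1], and it is where [m <= m_L] enters. *)
Lemma beta_low_ge m : 1 < m -> m <= m_L Gamma -> 1 + Gamma <= Gamma / (2 * (m - 1)).
Proof.
have G0 := Gamma0; move=> m1; rewrite /m_L => mL; rewrite ler_pdivlMr; last by lra.
have : (1 + Gamma) * (2 * (m - 1)) <= (1 + Gamma) * (2 * (Gamma / (2 * (1 + Gamma)))).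
  by rewrite ler_pM2l; lra.
by have -> : (1 + Gamma) * (2 * (Gamma / (2 * (1 + Gamma)))) = Gamma by field; rewrite gt_eqF//; lra.
Qed.

Lemma I_G_low_ge m psi : 2 <= psi -> 1 < m -> m <= m_L Gamma ->
  ((calI 1 (Gamma / (2 * (m - 1))))%:E <= I_G sigma m psi Gamma)%E.
Proof.
have G0 := Gamma0; move=> psi2 m1 mL; have bG := beta_low_ge m1 mL.
set b := Gamma / _ in bG *; have b0 : 0 < b by lra.
rewrite -(Phi_calI Gamma0 (m := m))//.
  apply: I_G_ge_lo => //; rewrite ?mul1r; [lra|lra|].
  by right; split => //; lra.
by rewrite joukowski1 /b; field; rewrite !gt_eqF//; lra.
Qed.

(** The infimum in [F] is approached at the edge [psi = J 1], so the boundary alternative of [slope]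
    applies. *)
Lemma I_G_low m : 1 < m -> m <= m_L Gamma ->
  I_G sigma m 2 Gamma = (calI 1 (Gamma / (2 * (m - 1))))%:E.
Proof.
have G0 := Gamma0; move=> m1 mL; apply/eqP; rewrite eq_le I_G_low_ge// andbT.
have bG := beta_low_ge m1 mL; set b := Gamma / _ in bG *.
have b0 : 0 < b by lra.
have b1 : 1 <= b by lra.
have mE : 2 * m = 2 + Gamma / b by rewrite /b; field; rewrite !gt_eqF//; lra.
rewrite -(Phi_calI Gamma0 (m := m))//; last by rewrite joukowski1.
apply: (le_trans (@I_G_le_tilted R Gamma 2 m 1 b 0 Gamma0 _ _ b1 _ _ _ _ _ _)) => //.
- by rewrite mul1r; lra.
- by rewrite joukowski1.
- by left.
- by rewrite joukowski1 mulr0 mul0r addr0.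
- right; split; first by rewrite joukowski1.
  by rewrite mul0r addr0 mul1r ler_pdivrMr; lra.
rewrite lee_fin /Phi joukowski1; have -> : 2 * m - 2 = Gamma / b by lra.
have -> : (2 - J b) * (Gamma / b) / Gamma = (2 - J b) / b by field; rewrite !gt_eqF.
lra.
Qed.

(** Under [a * b = 1 + Gamma] the threshold is the point where [a = b]; up to it the dual bound
    holds for every [psi], a uniformity that the annealed problem uses. *)
Lemma I_G_free_ge a psi : 2 <= psi -> 1 <= a -> a <= Num.sqrt (1 + Gamma) ->
  ((calI a ((1 + Gamma) / a))%:E <= I_G sigma (free_mean Gamma a) psi Gamma)%E.
Proof.
have G0 := Gamma0; move=> psi2 a1 aS; have a0 : 0 < a by lra.
have a0' : a != 0 by rewrite gt_eqF.
have s2 : Num.sqrt (1 + Gamma) ^+ 2 = 1 + Gamma by rewrite sqr_sqrtr//; lra.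
have ab : a * ((1 + Gamma) / a) = 1 + Gamma by field.
have leab : a <= (1 + Gamma) / a by rewrite ler_pdivlMr//; nra.
have b0 : 0 < (1 + Gamma) / a by lra.
rewrite -(Phi_calI Gamma0 a0 b0 (free_meanE Gamma0 a0)).
apply: I_G_ge_lo => //; rewrite ab; first by lra.
by left; ring.
Qed.

(** The measure without atom is optimal as long as [b >= 1]; the matching dual bound depends on the
    order of [a] and [b]. *)
Lemma I_G_free a : 1 <= a -> a <= 1 + Gamma ->
  I_G sigma (free_mean Gamma a) 2 Gamma = (calI a ((1 + Gamma) / a))%:E.
Proof.
have G0 := Gamma0; move=> a1 aU; have a0 : 0 < a by lra.
have a0' : a != 0 by rewrite gt_eqF.
have ab : a * ((1 + Gamma) / a) = 1 + Gamma by field.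
have b1 : 1 <= (1 + Gamma) / a by rewrite ler_pdivlMr// mul1r.
have b0 : 0 < (1 + Gamma) / a by lra.
apply/eqP; rewrite eq_le; apply/andP; split.
  rewrite -(Phi_calI Gamma0 a0 b0 (free_meanE Gamma0 a0)).
  have mE := free_meanE Gamma0 a0.
  set b := (1 + Gamma) / a in ab b1 b0 mE *.
  apply: (le_trans (@I_G_le_tilted R Gamma 2 (free_mean Gamma a) a b 0 Gamma0 _ a1 b1 _ _ _ _ _ _)) => //.
  - by rewrite ab; lra.
  - exact: joukowski_ge2.
  - by left.
  - by rewrite mulr0 mul0r addr0.
  - left; rewrite mul0r addr0 ab; have -> : 1 + Gamma - 1 = Gamma by ring.
    by rewrite divff// gt_eqF.
  rewrite lee_fin /Phi; have -> : 2 * free_mean Gamma a - J a = Gamma / b by lra.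
  have -> : (J a - J b) * (Gamma / b) / Gamma = (J a - J b) / b by field; rewrite !gt_eqF.
  lra.
have [aS|Sa] := leP a (Num.sqrt (1 + Gamma)); first exact: I_G_free_ge.
have s2 : Num.sqrt (1 + Gamma) ^+ 2 = 1 + Gamma by rewrite sqr_sqrtr//; lra.
have s0 : 0 <= Num.sqrt (1 + Gamma) by exact: sqrtr_ge0.
rewrite -(Phi_calI Gamma0 a0 b0 (free_meanE Gamma0 a0)).
apply: I_G_ge_hi => //.
- by rewrite ler_pdivrMr//; nra.
- exact: joukowski_ge2.
- by apply: joukowski_gt2; nra.
Qed.

Lemma I_G_high_ge a m : 1 < a -> ((Phi Gamma a 1 m)%:E <= I_G sigma m 2 Gamma)%E.
Proof.
move=> a1; apply: I_G_ge_hi => //; [exact: ltW|by rewrite joukowski1|exact: joukowski_gt2].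
Qed.

(** With [b = 1] and an atom at [2], the constraint and criticality determine [a] and [c].
    Eliminating [c] gives the equation for [a], and [1 + Gamma <= a] makes [c] nonnegative. *)
Lemma I_G_high a m : 1 + Gamma <= a -> 2 * m = 2 * a - 2 + (2 + Gamma) / a ->
  I_G sigma m 2 Gamma = (Phi Gamma a 1 m)%:E.
Proof.
have G0 := Gamma0; move=> aU mE; have a1 : 1 < a by lra.
have a0 : 0 < a by lra.
apply/eqP; rewrite eq_le I_G_high_ge// andbT.
have J2 := joukowski_gt2 a1.
(* The mass prescribed by the constraint; it is [frakT Gamma m a]. *)
pose c := (J a - 2) * (2 * m - J a - Gamma) / Gamma.
have mJ : 2 * m - J a - Gamma = (a - 1) * (a - (1 + Gamma)) / a.
  by rewrite mE /joukowski; field; rewrite gt_eqF.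
have JE : J a - 2 = (a - 1) ^+ 2 / a by rewrite /joukowski; field; rewrite gt_eqF.
have c0 : 0 <= c.
  apply: divr_ge0; last exact: ltW.
  apply: mulr_ge0; first by lra.
  by rewrite mJ; apply: divr_ge0; [apply: mulr_ge0; lra|exact: ltW].
have a1' : a - 1 != 0 by rewrite subr_eq0 gt_eqF.
apply: (le_trans (@I_G_le_tilted R Gamma 2 m a 1 c Gamma0 _ _ _ _ _ _ _ _ _)) => //.
- exact: ltW.
- by rewrite mulr1.
- exact: ltW.
- by right.
- by rewrite /c; field; rewrite !gt_eqF//; lra.
- left; rewrite mulr1 /c mJ JE.
  by field; rewrite a1' !gt_eqF.
rewrite lee_fin /Phi joukowski1 /c invr1 mulr1.
rewrite le_eqVlt; apply/orP; left; apply/eqP.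
by field; rewrite gt_eqF.
Qed.

Lemma alpha_highP m : m_U Gamma <= m ->
  let a := 2^-1 * ((m + 1) + Num.sqrt ((m + 1) ^+ 2 - 4 - 2 * Gamma)) in
  1 + Gamma <= a /\ 2 * m = 2 * a - 2 + (2 + Gamma) / a.
Proof.
have G0 := Gamma0; move=> mU a.
have G1 : 1 + Gamma != 0 by rewrite gt_eqF//; lra.
(* The difference at [m = m_U] of the roots of [2 * a ^+ 2 - 2 * (m + 1) * a + 2 + Gamma]: the
   larger is [1 + Gamma], and their product is [1 + Gamma / 2]. *)
pose d := (1 + Gamma) - (1 + Gamma / 2) / (1 + Gamma).
have dE : d * (1 + Gamma) = Gamma ^+ 2 + 3 / 2 * Gamma by rewrite /d; field.
have d0 : 0 <= d by rewrite -(@pmulr_lge0 _ (1 + Gamma)) ?dE; nra.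
have mU1 : m_U Gamma + 1 = 2 * (1 + Gamma) - d by rewrite /m_U /d; field.
have d2 : (m_U Gamma + 1) ^+ 2 - 4 - 2 * Gamma = d ^+ 2.
  by rewrite mU1 /d; field.
have mU0 : 0 <= m_U Gamma + 1 by have [? ? ? ?] := m_order; lra.
have disc : d ^+ 2 <= (m + 1) ^+ 2 - 4 - 2 * Gamma by rewrite -d2; nra.
set s := Num.sqrt _ in a *.
have s0 : 0 <= s by exact: sqrtr_ge0.
have ss : s ^+ 2 = (m + 1) ^+ 2 - 4 - 2 * Gamma.
  by rewrite sqr_sqrtr// (le_trans _ disc)// sqr_ge0.
have ds : d <= s by nra.
have aU : 1 + Gamma <= a by rewrite /a; lra.
split => //; have a0 : a != 0 by rewrite gt_eqF//; lra.
apply: (mulIf a0); rewrite [RHS]mulrDl divfK//.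
by rewrite /a; nra.
Qed.

Lemma alpha_beta_q_free a : 1 < a -> a < 1 + Gamma ->
  alpha_q Gamma (free_mean Gamma a) = a /\
  beta_q Gamma (free_mean Gamma a) = (1 + Gamma) / a.
Proof.
have G0 := Gamma0; move=> a1 aU; have [aE bE] := free_params Gamma0 (ltW a1).
rewrite /alpha_q /beta_q -(free_mean1 Gamma0) -(free_mean_U Gamma0).
rewrite (free_mean_le Gamma0 (ltW a1) (lexx 1)) leNgt a1 /= free_mean_lt//.
exact: ltW.
Qed.

Lemma I_G_quenched m : 1 < m ->
  I_G sigma m 2 Gamma =
    (calI (alpha_q Gamma m) (beta_q Gamma m) +
     2^-1 * frakT Gamma m (alpha_q Gamma m) *
     \1_[set m' | m_U Gamma <= m'] m)%:E.
Proof.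
have G0 := Gamma0; move=> m1; have [mL|Lm] := leP m (m_L Gamma).
  rewrite /alpha_q /beta_q mL indicE memNset ?mulr0 ?addr0 ?I_G_low//=.
  by have [? ? ? ?] := m_order; lra.
have [mU|Um] := ltP m (m_U Gamma).
  have [a a1 aE] := free_mean_surj Gamma0 (ltW Lm).
  have a1' : 1 < a.
    by rewrite ltNge -(free_mean_le Gamma0 a1 (lexx 1)) -ltNge aE free_mean1.
  have aU : a < 1 + Gamma.
    rewrite ltNge -(@free_mean_le _ _ Gamma0 (1 + Gamma) a) ?free_mean_U//; last by lra.
    by rewrite -ltNge aE.
  rewrite -aE; have [-> ->] := alpha_beta_q_free a1' aU.
  rewrite indicE memNset ?mulr0 ?addr0 ?I_G_free//; first exact: ltW.
  by rewrite /= aE; lra.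
have [aU aE] := alpha_highP Um.
rewrite /alpha_q /beta_q leNgt Lm ltNge Um /= indicE mem_set//= mulr1.
set a := 2^-1 * _ in aU aE *.
rewrite (I_G_high aU aE); congr EFin.
have a0 : 0 < a by lra.
rewrite /Phi /calI /J_1 /frakT /logpot /joukowski ln1 divr1 invr1 expr1n.
by field; rewrite !gt_eqF.
Qed.

Lemma alpha_q_le_beta_q m : 1 < m ->
  alpha_q Gamma m <= beta_q Gamma m <-> m <= m_bar Gamma.
Proof.
have G0 := Gamma0; move=> m1; have [_ _ Lb bU] := m_order.
have [mL|Lm] := leP m (m_L Gamma).
  split=> _; first by lra.
  by rewrite /alpha_q /beta_q mL; have := beta_low_ge m1 mL; lra.
have s2 : Num.sqrt (1 + Gamma) ^+ 2 = 1 + Gamma by rewrite sqr_sqrtr//; lra.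
have s0 : 0 <= Num.sqrt (1 + Gamma) by exact: sqrtr_ge0.
have s1 : 1 <= Num.sqrt (1 + Gamma) by nra.
have [mU|Um] := ltP m (m_U Gamma).
  have [a a1 aE] := free_mean_surj Gamma0 (ltW Lm).
  have a1' : 1 < a.
    by rewrite ltNge -(free_mean_le Gamma0 a1 (lexx 1)) -ltNge aE free_mean1.
  have aU : a < 1 + Gamma.
    rewrite ltNge -(@free_mean_le _ _ Gamma0 (1 + Gamma) a) ?free_mean_U//; last by lra.
    by rewrite -ltNge aE.
  rewrite -aE; have [-> ->] := alpha_beta_q_free a1' aU.
  rewrite -(free_mean_bar Gamma0) free_mean_le// ler_pdivlMr; last by lra.
  by split=> ?; nra.
have [aU aE] := alpha_highP Um.
rewrite /alpha_q /beta_q (leNgt m (m_L Gamma)) Lm (ltNge m) Um /=.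
by split=> ?; lra.
Qed.

(** Past the threshold [a = b] the bound depends on [psi = J p]. Taking [t = p] leaves
    [Phi + edge_cost], whose minimum over [p >= 1] is at [b^-1] or at [1]. *)
Lemma I_GA_ge m psi : 2 <= psi -> 1 < m ->
  ((annealed_rate Gamma m)%:E <= I_G sigma m psi Gamma + I_e psi)%E.
Proof.
have G0 := Gamma0; move=> psi2 m1.
have [mL|Lm] := leP m (m_L Gamma).
  by rewrite /annealed_rate mL; apply: le_trans (I_G_low_ge psi2 m1 mL) _; rewrite leeDl// I_e_ge0.
have [a a1 aE] := free_mean_surj Gamma0 (ltW Lm).
rewrite -aE annealed_rate_free//.
have [aS|Sa] := leP a (Num.sqrt (1 + Gamma)).
  by apply: le_trans (I_G_free_ge psi2 a1 aS) _; rewrite leeDl// I_e_ge0.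
have s2 : Num.sqrt (1 + Gamma) ^+ 2 = 1 + Gamma by rewrite sqr_sqrtr//; lra.
have s0 : 0 <= Num.sqrt (1 + Gamma) by exact: sqrtr_ge0.
have [p p1 pE] := joukowski_surj psi2.
have a0 : 0 < a by lra.
have mE := free_meanE Gamma0 a0; set b := (1 + Gamma) / a in mE *.
have ba : b < a by rewrite /b ltr_pdivrMr//; nra.
have b0 : 0 < b by rewrite divr_gt0//; lra.
have a1' : 1 < a by nra.
have v0 : 0 < b^-1 by rewrite invr_gt0.
have va : b^-1 < a.
  by rewrite -[a]invrK ltf_pV2 ?posrE ?invr_gt0// /b ltr_pdivlMr// mulVf ?gt_eqF//; lra.
have phase t : 1 <= t -> Phi Gamma a t (free_mean Gamma a) + edge_cost t <= edge_cost a ->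
    (p < a -> Phi Gamma a t (free_mean Gamma a) + edge_cost t <=
       Phi Gamma a p (free_mean Gamma a) + edge_cost p) ->
    ((Phi Gamma a t (free_mean Gamma a) + edge_cost t)%:E <=
       I_G sigma (free_mean Gamma a) psi Gamma + I_e psi)%E.
  move=> t1 ta tp; rewrite -pE I_e_joukowski//.
  have [pa|ap] := ltP p a.
    apply: (@le_trans _ _ (Phi Gamma a p (free_mean Gamma a) + edge_cost p)%:E).
      by rewrite lee_fin tp.
    rewrite EFinD leeD2r//; apply: I_G_ge_hi => //; rewrite ?pE//; first exact: ltW.
    by rewrite -pE joukowski_lt.
  apply: (@le_trans _ _ (edge_cost p)%:E).
    by rewrite lee_fin (le_trans ta)// edge_cost_le.
  by rewrite leeDr// I_G_ge0// pE.
have mE' : 2 * free_mean Gamma a = J a + Gamma * b^-1 by [].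
have [b1|b1] := leP 1 b; last first.
  have v1 : 1 <= b^-1 by rewrite ltW// invf_gt1.
  have <- : Phi Gamma a b^-1 (free_mean Gamma a) + edge_cost b^-1 = calI a b.
    by rewrite (Phi_edge_cost Gamma0 a0 v0 mE') invrK.
  have incr := @Phi_edge_cost_incr _ _ Gamma0 a (free_mean Gamma a) b^-1.
  apply: phase => //.
    by have := incr b^-1 a v1 (ltW va) (lexx _) mE'; rewrite Phi_diag add0r.
  move=> pa; have [vp|pv] := leP b^-1 p; first exact: incr.
  exact: (@Phi_edge_cost_decr _ _ Gamma0 a (free_mean Gamma a) b^-1 p b^-1 p1 (ltW pv) (lexx _) mE').
have v1 : b^-1 <= 1 by rewrite invf_le1.
rewrite -(Phi_calI Gamma0 a0 b0 mE).
(* If [p < b], the bound with [t = b] suffices without any edge price; if [p >= b], the expression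
   increases from its value at [b], since [b^-1 <= 1 <= b]. *)
have [bp|pb] := leP b p; last first.
  apply: (@le_trans _ _ (I_G sigma (free_mean Gamma a) psi Gamma)); last by rewrite leeDl// I_e_ge0.
  apply: I_G_ge_hi => //; first exact: ltW.
    by rewrite -pE joukowski_le// ltW.
  by rewrite -pE joukowski_lt// (lt_trans pb).
have incr := @Phi_edge_cost_incr _ _ Gamma0 a (free_mean Gamma a) b^-1 b.
apply: (@le_trans _ _ (Phi Gamma a b (free_mean Gamma a) + edge_cost b)%:E).
  by rewrite lee_fin lerDl edge_cost_ge0.
apply: phase => //.
  by have := incr a b1 (ltW ba) (le_trans v1 b1) mE'; rewrite Phi_diag add0r.
by move=> pa; apply: incr => //; exact: le_trans b1.
Qed.

Lemma I_GA_le m psi : 2 <= psi -> (I_GA m Gamma <= I_G sigma m psi Gamma + I_e psi)%E.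
Proof. by move=> psi2; apply: ereal_inf_lbound; exists psi. Qed.

Lemma I_e2 : I_e (2 : R) = 0%E.
Proof. by rewrite -joukowski1 I_e_joukowski// edge_cost1. Qed.

Lemma I_GA_eq m : 1 < m -> I_GA m Gamma = (annealed_rate Gamma m)%:E.
Proof.
have G0 := Gamma0; move=> m1; apply/eqP; rewrite eq_le; apply/andP; split; last first.
  by apply: le_ereal_inf_tmp => _ [psi psi2 <-]; exact: I_GA_ge.
have [mL|Lm] := leP m (m_L Gamma).
  apply: (le_trans (I_GA_le m (lexx 2))).
  by rewrite I_e2 adde0 I_G_low// /annealed_rate mL.
have [a a1 aE] := free_mean_surj Gamma0 (ltW Lm).
rewrite -aE annealed_rate_free//.
have [aU|Ua] := leP a (1 + Gamma).
  apply: (le_trans (I_GA_le _ (lexx 2))).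
  by rewrite I_e2 adde0 I_G_free.
have a0 : 0 < a by lra.
(* [J v] is the edge that minimizes the lower bound; [v] plays the role of [b] in the density and
   also locates the atom. *)
pose v := a / (1 + Gamma).
have v1 : 1 < v by rewrite /v ltr_pdivlMr; lra.
have v0 : 0 < v by lra.
have aV : a = (1 + Gamma) * v by rewrite /v; field; rewrite gt_eqF//; lra.
have -> : (1 + Gamma) / a = v^-1 by rewrite /v invf_div.
have va : v < a by rewrite aV; nra.
have mE : 2 * free_mean Gamma a = J a + Gamma * v.
  by rewrite free_meanE//; congr (_ + _); rewrite /v; field; rewrite !gt_eqF//; lra.
have psi2 := joukowski_ge2 (ltW v1).
have Jva := joukowski_lt (ltW v1) va.
apply: (le_trans (I_GA_le _ psi2)).
have v1' := ltW v1.
rewrite I_e_joukowski// -(Phi_edge_cost Gamma0 a0 v0 mE) [leRHS]EFinD.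
apply: leeD => //.
(* The mass that turns the term [Gamma / v] of the measure without atom into the required
   [Gamma * v]. *)
pose c := (v - v^-1) * (J a - J v).
have vV : v^-1 <= v by apply: (@le_trans _ _ 1); [rewrite invf_le1; lra|lra].
have c0 : 0 <= c by rewrite mulr_ge0//; lra.
have JJ : J a - J v != 0 by rewrite subr_eq0 gt_eqF.
apply: (le_trans (@I_G_le_tilted R Gamma (J v) (free_mean Gamma a) a v c Gamma0 _ a1 (ltW v1) _ c0 _ _ _ _)) => //.
- by nra.
- exact: ltW.
- by right.
- by rewrite mE /c; field; rewrite JJ gt_eqF.
- left.
  have av1 : (1 + Gamma) * v ^+ 2 - 1 != 0 by rewrite gt_eqF//; nra.
  have -> : c / (J a - J v) ^+ 2 = (v - v^-1) / (J a - J v).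
    by rewrite /c; field; rewrite JJ gt_eqF.
  have -> : J a - J v = Gamma * ((1 + Gamma) * v ^+ 2 - 1) / ((1 + Gamma) * v).
    by rewrite aV /joukowski; field; rewrite !gt_eqF//; lra.
  have -> : a * v - 1 = (1 + Gamma) * v ^+ 2 - 1 by rewrite aV; ring.
  by field; rewrite av1 !gt_eqF//; lra.
rewrite lee_fin /Phi /c; have -> : 2 * free_mean Gamma a - J a = Gamma * v by lra.
rewrite le_eqVlt; apply/orP; left; apply/eqP.
by field; rewrite !gt_eqF.
Qed.

Lemma I_GA_le1 m : m <= 1 -> I_GA m Gamma = +oo%E.
Proof.
move=> m1; apply/eqP; rewrite -leye_eq; apply: le_ereal_inf_tmp => _ [psi psi2 <-].
by rewrite I_G_le1// addye// -ltNye (lt_le_trans _ (I_e_ge0 psi)).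
Qed.

End rate_functions_values.

(** * Compactness of sublevel sets *)

Section sublevel_sets.
Context {R : realType}.
Variable Gamma : R.
Hypothesis Gamma0 : 0 < Gamma.
Notation sigma := (semicircle_law R).
Implicit Types m c : R.

Lemma closed_le_affine (u v w c : R) : closed [set m | u + v * (m - w) <= c].
Proof.
have cf : continuous (fun m : R => u + v * (m - w)).
  move=> m; apply: cvgD; first exact: cvg_cst.
  apply: cvgM; first exact: cvg_cst.
  by apply: cvgB; [exact: cvg_id|exact: cvg_cst].
by apply: (closed_comp _ (@closed_le _ c)) => m _; exact: cf.
Qed.

Let gt1 m c (f : R -> \bar R) : (forall m, m <= 1 -> f m = +oo%E) ->
  (f m <= c%:E)%E -> 1 < m.
Proof. by move=> fE; case: ltP => // /fE ->; rewrite leye_eq. Qed.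

Lemma compact_I_GA c : compact [set m : R | (I_GA m Gamma <= c%:E)%E].
Proof.
have G0 := Gamma0; have [h1 h2 h3 h4] := critical_means Gamma0.
(* Between [1] and [lo] the logarithmic blow-up, and beyond [hi] the supporting line at [m_U], make
   the rate exceed [c]. *)
pose lo := Num.min (m_L Gamma) (1 + Gamma / 2 * expR (- (2 * c + 3 / 2))).
pose hi := m_U Gamma + Num.max 0 ((c - annealed_rate Gamma (m_U Gamma)) / annealed_slope Gamma (m_U Gamma)).
have lo1 : 1 < lo.
  by rewrite lt_min; apply/andP; split; [lra|rewrite ltrDl mulr_gt0 ?expR_gt0//; lra].
have sU := annealed_slope_U Gamma0.
have SE : [set m : R | (I_GA m Gamma <= c%:E)%E] = `[lo, hi]%classic `&`
    \bigcap_(x in [set x | 1 < x])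
      [set m | annealed_rate Gamma x + annealed_slope Gamma x * (m - x) <= c].
  apply/seteqP; split => m /=.
    move=> mc; have m1 := gt1 (I_GA_le1 Gamma0) mc.
    move: mc; rewrite I_GA_eq// lee_fin => mc; split; last first.
      by move=> x /= x1; apply: le_trans mc; exact: annealed_rate_support.
    rewrite in_itv/= (annealed_rate_low_bound Gamma0 m1 mc)/=.
    have U1 : 1 < m_U Gamma by lra.
    have := annealed_rate_support Gamma0 U1 m1.
    rewrite -lerBlDl /hi le_max => H; apply/orP; right.
    by rewrite ler_pdivlMr// mulrC; lra.
  move=> [/[!in_itv]/= /andP[lom _] H]; have m1 : 1 < m by lra.
  by rewrite I_GA_eq// lee_fin; have := H m m1; rewrite /= subrr mulr0 addr0.
rewrite SE; apply: (subclosed_compact _ (@segment_compact R lo hi)); last by move=> x [].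
apply: closedI; first exact: interval_closed.
by apply: closed_bigI => x _; exact: closed_le_affine.
Qed.

Lemma I_GA_eq_I_G m : m <= m_U Gamma -> I_GA m Gamma = I_G sigma m 2 Gamma.
Proof.
have G0 := Gamma0; move=> mU.
have [m1|m1] := leP m 1; first by rewrite I_GA_le1// I_G_le1.
rewrite I_GA_eq//; have [mL|Lm] := leP m (m_L Gamma).
  by rewrite I_G_low// /annealed_rate mL.
have [a a1 aE] := free_mean_surj Gamma0 (ltW Lm).
rewrite -aE annealed_rate_free// I_G_free//.
by rewrite -(@free_mean_le _ _ Gamma0)// ?aE ?free_mean_U//; lra.
Qed.

(** Up to [m_U] the two rates agree; beyond it the quenched rate is the largest of its dual bounds,
    affine in [m]. The sublevel set is thus closed, and it lies in the compact annealed one. *)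
Lemma compact_I_G c : compact [set m : R | (I_G sigma m 2 Gamma <= c%:E)%E].
Proof.
have G0 := Gamma0; have cA := @compact_I_GA c.
have SE : [set m : R | (I_G sigma m 2 Gamma <= c%:E)%E] =
    ([set m : R | (I_GA m Gamma <= c%:E)%E] `&` [set m | m <= m_U Gamma]) `|`
    ([set m | m_U Gamma <= m] `&` \bigcap_(a in [set a | 1 < a])
      [set m | Phi Gamma a 1 0 + (joukowski a - 2) / Gamma * (m - 0) <= c]).
  have PhiE a m : Phi Gamma a 1 0 + (joukowski a - 2) / Gamma * (m - 0) = Phi Gamma a 1 m.
    by rewrite /Phi joukowski1; field; rewrite gt_eqF.
  apply/seteqP; split => m /=.
    move=> mc; have [mU|Um] := leP m (m_U Gamma); [left|right].
      by rewrite I_GA_eq_I_G.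
    split; first exact: ltW.
    move=> a /= a1; rewrite PhiE -lee_fin; apply: le_trans mc.
    exact: I_G_high_ge.
  case=> [[mc mU]|[Um H]]; first by rewrite -I_GA_eq_I_G.
  have [aU aE] := alpha_highP Gamma0 Um.
  set a := 2^-1 * _ in aU aE.
  rewrite (I_G_high Gamma0 aU aE) lee_fin -PhiE; apply: H => /=; lra.
apply: (subclosed_compact _ cA).
  rewrite SE; apply: closedU.
    by apply: closedI; [exact: compact_closed|exact: closed_le].
  apply: closedI; first exact: closed_ge.
  by apply: closed_bigI => x _; exact: closed_le_affine.
move=> m /= mc; apply: le_trans mc.
by have := I_GA_le Gamma m (lexx 2); rewrite I_e2 adde0.
Qed.

End sublevel_sets.

Theorem proposition1p11 (R : realType) (Gamma : R) (Gamma_gt0 : 0 < Gamma) :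
  [/\ 1 < m_c Gamma, m_c Gamma < m_L Gamma, m_L Gamma < m_bar Gamma
    & m_bar Gamma < m_U Gamma] /\
  [/\ good_rate_function (fun m : R => I_G (semicircle_law R) m 2 Gamma),
      (forall m : R, m <= 1 -> I_G (semicircle_law R) m 2 Gamma = +oo%E),
      (forall m : R, 1 < m ->
         I_G (semicircle_law R) m 2 Gamma =
         (calI (alpha_q Gamma m) (beta_q Gamma m) +
          2^-1 * frakT Gamma m (alpha_q Gamma m) *
          \1_[set m' | m_U Gamma <= m'] m)%:E)
    & (forall m : R, 1 < m ->
         (alpha_q Gamma m <= beta_q Gamma m <-> m <= m_bar Gamma))] /\
  [/\ good_rate_function (fun m : R => I_GA m Gamma),
      (forall m : R, m <= 1 -> I_GA m Gamma = +oo%E),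
      strictly_convex (fun m : R => I_GA m Gamma),
      (forall m : R, 1 <= m <= m_U Gamma ->
         I_GA m Gamma = I_G (semicircle_law R) m 2 Gamma)
    & (forall m : R, m_U Gamma < m ->
         I_GA m Gamma = (calI (alpha_a Gamma m) (beta_aV Gamma m))%:E)].
Proof.
have G0 := Gamma_gt0; have [h1 h2 h3 h4] := critical_means Gamma_gt0.
split; first by split.
split; split.
- split; first by move=> m; exact: I_G_ge0.
  exact: compact_I_G.
- by move=> m m1; exact: I_G_le1.
- exact: I_G_quenched.
- exact: alpha_q_le_beta_q.
- split; last exact: compact_I_GA.
  move=> m; apply: le_ereal_inf_tmp => _ [psi psi2 <-].
  by rewrite adde_ge0 ?I_e_ge0// I_G_ge0.
- exact: I_GA_le1.
- move=> x y t fx fy xy t01.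
  (* Finiteness places both endpoints beyond [1], which reduces the claim to the real-valued
     rate. *)
  have gt1 z : I_GA z Gamma \is a fin_num -> 1 < z.
    by move=> fz; rewrite ltNge; apply/negP => z1; rewrite I_GA_le1 in fz.
  have x1 := gt1 x fx; have y1 := gt1 y fy.
  have z1 : 1 < t * x + (1 - t) * y by case/andP: t01 => ? ?; nra.
  by rewrite !I_GA_eq// -!EFinM -EFinD lte_fin; exact: annealed_rate_convex.
- by move=> m /andP[_ mU]; exact: I_GA_eq_I_G.
- move=> m Um; rewrite I_GA_eq//; last by lra.
  by rewrite /annealed_rate leNgt ifF//; apply/negbTE; rewrite negbK; lra.
Qed.
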